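(* Let $0<\alpha<1$, let $I\subset\mathbb{R}$ be an interval, $t_0\in I$, let $A$ be an $n\times n$ matrix function continuous on $I$, let $u:I\to\mathbb{R}^n$ be continuous on $I$, and let $x_0\in\mathbb{R}^n$. Assume that the generalized Peano--Baker series $\tilde{\Phi}(t,t_0)=\sum_{k=0}^{\infty}{}_{t_0}\tilde{J}_t^{k\circ\alpha}A(t)$ converges uniformly in $t\in I$, $t\ge t_0$. Then a solution to the initial value problem $${}_{t_0}D_t^{(\alpha)}x(t)=A(t)x(t)+u(t),\quad t\in I,\ t>t_0,\qquad x(t_0)=x_0,$$ is given by $$x(t)=\tilde{\Phi}(t,t_0)x_0+\int_{t_0}^t\Phi(t,\tau)u(\tau)\,d\tau .$$
   Context: The Riemann--Liouville fractional integral of order $\beta>0$ and the Caputo (regularized) derivative of order $\alpha\in(0,1)$, with lower limit $s\in I$ and $t\in I$, $t>s$, are $${}_{s}J_t^{\beta}f(t)=\frac{1}{\Gamma(\beta)}\int_{s}^t(t-\tau)^{\beta-1}f(\tau)\,d\tau,\qquad {}_{s}D_t^{(\alpha)}f(t)={}_{s}J_t^{1-\alpha}\frac{d}{dt}f(t),$$ applied entrywise to vector and matrix functions. Let $\mathrm{Id}$ be the $n\times n$ identity matrix. State-transition matrix (Caputo case): $\tilde{\Phi}(t,t_0)=\sum_{k=0}^{\infty}{}_{t_0}\tilde{J}_t^{k\circ\alpha}A(t)$, where $${}_{t_0}\tilde{J}_t^{0\circ\alpha}A(t)=\mathrm{Id},\qquad {}_{t_0}\tilde{J}_t^{(k+1)\circ\alpha}A(t)={}_{t_0}J_t^{\alpha}\bigl(A(t)\,{}_{t_0}\tilde{J}_t^{k\circ\alpha}A(t)\bigr),\quad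 k=0,1,\ldots$$ State-transition matrix (Riemann--Liouville case): for $s,t\in I$, $s<t$, $\Phi(t,s)=\sum_{k=0}^{\infty}{}_{s}J_t^{k\circ\alpha}A(t)$, where $${}_{s}J_t^{0\circ\alpha}A(t)=\frac{(t-s)^{\alpha-1}}{\Gamma(\alpha)}\mathrm{Id},\qquad {}_{s}J_t^{(k+1)\circ\alpha}A(t)={}_{s}J_t^{\alpha}\bigl(A(t)\,{}_{s}J_t^{k\circ\alpha}A(t)\bigr),\quad k=0,1,\ldots$$
   Formalization: For merely continuous u the solution may be nowhere differentiable, so the Caputo derivative is taken in regularized form, d/dt of J^(1-α)(x − x(t_0)), at every t > t_0; the literal form J^(1-α)(dx/dt) is asserted wherever x is absolutely continuous and that integral converges absolutely. *)

(* Defs.v *)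
From HB Require Import structures.
From mathcomp Require Import all_boot all_order all_algebra.
From mathcomp Require Import all_classical all_reals all_analysis.

Set Implicit Arguments.
Unset Strict Implicit.
Unset Printing Implicit Defensive.

Import Order.TTheory GRing.Theory Num.Theory numFieldNormedType.Exports.

Local Open Scope classical_set_scope.
Local Open Scope ring_scope.

Definition Gamma {R : realType} (z : R) : R :=
  \int[lebesgue_measure]_(t in `]0, +oo[) (t `^ (z - 1) * expR (- t)).

(* The integrand of the Riemann-Liouville integral, up to 1 / Gamma b.  Since
   0 `^ b = 0 for b != 0, it takes a finite junk value at tau = t, a null set. *)
Definition RL_integrand {R : realType} (b : R) (f : R -> R) (t tau : R) : R :=
  (t - tau) `^ (b - 1) * f tau.

Definition RL_int {R : realType} (b s : R) (f : R -> R) (t : R) : R :=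
  (Gamma b)^-1 * \int[lebesgue_measure]_(tau in `[s, t]) RL_integrand b f t tau.

Definition mxRL_int {R : realType} {m n : nat} (b s : R)
    (F : R -> 'M[R]_(m, n)) (t : R) : 'M[R]_(m, n) :=
  \matrix_(i, j) RL_int b s (fun tau => F tau i j) t.

(* The two families of iterated integrals differ only in the term of index 0. *)
Fixpoint PB_iter {R : realType} {n : nat} (a s : R) (A F0 : R -> 'M[R]_n)
    (k : nat) : R -> 'M[R]_n :=
  if k is k'.+1 then
    mxRL_int a s (fun tau => A tau *m PB_iter a s A F0 k' tau)
  else F0.

Definition caputo_term {R : realType} {n : nat} (a s : R) (A : R -> 'M[R]_n) :
  nat -> R -> 'M[R]_n := PB_iter a s A (fun _ => 1%:M).

Definition RL_term {R : realType} {n : nat} (a s : R) (A : R -> 'M[R]_n) :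
  nat -> R -> 'M[R]_n :=
  PB_iter a s A (fun t => ((t - s) `^ (a - 1) / Gamma a)%:M).

Definition caputo_Phi {R : realType} {n : nat} (a : R) (A : R -> 'M[R]_n)
    (t s : R) : 'M[R]_n :=
  limn (series (fun k => caputo_term a s A k t)).

Definition RL_Phi {R : realType} {n : nat} (a : R) (A : R -> 'M[R]_n)
    (t s : R) : 'M[R]_n :=
  limn (series (fun k => RL_term a s A k t)).

(* J^(1-a) (df/dt). *)
Definition caputo {R : realType} (a s : R) (f : R -> R) (t : R) : R :=
  RL_int (1 - a) s (derive1 f) t.

(* The conditions under which [caputo a s f t] is meaningful: f is absolutely
   continuous on [s, t] (it is the indefinite Lebesgue integral of its
   derivative), and the integral J^(1-a) of f' converges absolutely at t. *)
Definition caputo_defined {R : realType} (a s : R) (f : R -> R) (t : R) : Prop :=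
  [/\ lebesgue_measure.-integrable `[s, t] (EFin \o derive1 f),
      forall r, r \in `[s, t] ->
        f r = f s + \int[lebesgue_measure]_(tau in `[s, r]) derive1 f tau
    & lebesgue_measure.-integrable `[s, t]
        (EFin \o RL_integrand (1 - a) (derive1 f) t)].

(* The regularized form d/dt J^(1-a) (f - f(s)) of J^(1-a) (df/dt): v is the
   value at t of the derivative, taken within I (so one-sided at an end point
   of I).  For f merely continuous, df/dt is the distributional derivative,
   and J^(1-a) (df/dt) = d/dt J^(1-a) (f - f(s)); this reading is
   needed because J^a g need not have a classical derivative at any point, nor
   be absolutely continuous, when g is only continuous. *)
Definition is_caputo {R : realType} (I : interval R) (a s : R) (f : R -> R)
    (t v : R) : Prop :=
  let F := RL_int (1 - a) s (fun tau => f tau - f s) in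
  (F r - F t) / (r - t) @[r --> within [set` I] t^'] --> v.

(* x solves D^(a) x = A x + u for t > t0 in I, with x t0 = x0.  The equation is
   required in the regularized form at every t, and also in the classical form
   J^(1-a) (dx/dt) wherever the latter is meaningful. *)
Definition caputo_solution {R : realType} {n : nat} (I : interval R) (a t0 : R)
    (A : R -> 'M[R]_n) (u : R -> 'cV[R]_n) (x0 : 'cV[R]_n)
    (x : R -> 'cV[R]_n) : Prop :=
  [/\ {within [set t | t \in I /\ t0 <= t], continuous x},
      x t0 = x0
    & forall t, t \in I -> t0 < t -> forall i : 'I_n,
        let xi := fun tau => x tau i 0 in
        let v := (A t *m x t + u t) i 0 in
        is_caputo I a t0 xi t v /\
        (caputo_defined a t0 xi t -> caputo a t0 xi t = v)].

(* Main.v *)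
Require Import Defs.
From HB Require Import structures.
From mathcomp Require Import all_boot all_order all_algebra.
From mathcomp Require Import all_classical all_reals all_analysis.
From mathcomp Require Import measurable_realfun.
From mathcomp Require Import ring lra.

(** Let x be the function given by the formula, and let J^b be the fractional
    integral with lower limit t0.  The formula is built so that x solves the
    Volterra equation x = x0 + J^a (A x + u) ([neumann_solP]).  Apply J^(1-a):
    since J^(1-a) J^a = J^1 ([rlint_beta]), the function J^(1-a) (x - x0) is the
    ordinary integral of A x + u, and A x + u is continuous, so the derivative
    of this integral is A x + u.

    The Volterra equation holds because both transition matrices are Neumann
    series.  On a compact interval [t0, T] contained in I, put V f = J^a (A f).
    The columns of Phi~ and of Phi(., r) are sums y of the V^k f, where f is a
    column of the identity matrix, respectively this column times
    (t - r)^(a-1) / Gamma a; hence y = f + V y as soon as V is a contraction in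
    a norm in which f is finite.  The norms are suprema of |f| / w for a weight
    w, and w = e^(l t) serves for Phi~, while w = (t - r)^(a-1) e^(l (t - r))
    absorbs the singularity of Phi(t, r) at t = r.  For both, the norm of V
    tends to 0 as l grows ([weight_expR], [weight_tpow],
    [exists_small_weight]).  By linearity, Phi~ x0 is the Neumann series of the
    constant x0.  By Fubini, V commutes with the integration over r
    ([conv_volt_sol]), so the integral of Phi(t, r) u(r) is the Neumann series
    of J^a u.  The sum of the two equations y = f + V y is the Volterra
    equation.

    The semigroup law J^(1-a) J^a = J^1 is Fubini together with the Beta
    integral of (r - v)^(-a) v^(a-1) over 0 < v < r.  This integral does not depend
    on r, by scaling, and it equals Gamma (1 - a) Gamma a, as one sees by
    integrating it against e^(-r) ([beta_tpow]).

    The equation in the classical form follows from the regularized form: when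
    f is absolutely continuous, J^(1-a) (f - f(t0)) = J^(2-a) f', and the left
    difference quotients of the right-hand side converge to J^(1-a) f' by
    dominated convergence ([caputo_of_is_caputo]).

    Throughout, integrals are taken over the whole line: the kernel v^(b-1) is
    extended by 0 to v <= 0, and A and u are cut off outside [t0, T].
    Translations, reflections and Fubini then involve no domain of
    integration. *)

Set Implicit Arguments.
Unset Strict Implicit.
Unset Printing Implicit Defensive.

Import Order.TTheory GRing.Theory Num.Theory numFieldNormedType.Exports.

Local Open Scope classical_set_scope.
Local Open Scope ring_scope.

(** * Affine changes of variables *)

Lemma measurable_affine {R : realType} (c d : R) :
  measurable_fun [set: R] (fun x : R => c * x + d : measurableTypeR R).
Proof. by apply: measurable_funD => //; exact: measurable_funM. Qed.

Lemma preimage_affine_itv {R : realType} (c d a b : R) : c != 0 ->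
  lebesgue_measure ((fun x => c * x + d) @^-1` `]a, b]) =
  (`|c|^-1%:E * lebesgue_measure (`]a, b] : set R))%E.
Proof.
move=> c0; have [c_gt0|c_lt0] : 0 < c \/ c < 0.
- by case: (ltgtP c 0) c0 => // *; [right|left].
- rewrite (_ : _ @^-1` _ = `](a - d) / c, (b - d) / c]%classic).
    rewrite !lebesgue_measure_itv/= !lte_fin ltr_pM2r ?invr_gt0// ltrD2r.
    case: ifPn => _; last by rewrite mule0.
    by rewrite -!EFinB -EFinM; congr EFin; rewrite gtr0_norm//; field.
  apply/seteqP; split => x /=; rewrite !in_itv/= ltr_pdivrMr// ler_pdivlMr//;
    by rewrite ltrBlDr lerBrDr mulrC.
- rewrite (_ : _ @^-1` _ = `[(b - d) / c, (a - d) / c[%classic).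
    rewrite !lebesgue_measure_itv/= !lte_fin ltr_nM2r ?invr_lt0// ltrD2r.
    case: ifPn => _; last by rewrite mule0.
    by rewrite -!EFinB -EFinM; congr EFin; rewrite ltr0_norm//; field.
  apply/seteqP; split => x /=; rewrite !in_itv/= ler_ndivrMr// ltr_ndivlMr//;
    by rewrite ltrBlDr lerBrDr mulrC andbC.
Qed.

(** Both sides are measures, so by the uniqueness of the Lebesgue measure it is
    enough to compare them on half-open intervals. *)
Lemma lebesgue_measure_affine {R : realType} (c d : R) (A : set R) :
  c != 0 -> measurable A ->
  (`|c|%:E * pushforward lebesgue_measure
     (fun x : R => c * x + d : measurableTypeR R)%R A =
   lebesgue_measure A)%E.
Proof.
move=> c0 mA; apply/esym.
apply: (lebesgue_measure_unique (mu := mscale (NngNum (normr_ge0 c))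
  (measure_function_pushforward__canonical__measure_function_Measure
   (@lebesgue_measure R) (measurable_affine c d)))) => //= _ [[a b]] _ <-.
rewrite /mscale/= /pushforward preimage_affine_itv//.
by rewrite muleA -EFinM divff ?mul1e// normr_eq0.
Qed.

Lemma ge0_integral_affine {R : realType} (c d : R) (f : R -> \bar R) :
  c != 0 -> measurable_fun [set: R] f -> (forall x, 0 <= f x)%E ->
  (\int[lebesgue_measure]_x f x =
   `|c|%:E * \int[lebesgue_measure]_x f (c * x + d)%R)%E.
Proof.
move=> c0 mf f0.
pose m1 := (measure_function_pushforward__canonical__measure_function_Measure
   (@lebesgue_measure R) (measurable_affine c d)).
transitivity (\int[mscale (NngNum (normr_ge0 c)) m1]_x f x)%E.
  apply: eq_measure_integral => /= A mA _.
  by rewrite /mscale/= lebesgue_measure_affine.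
rewrite ge0_integral_mscale//=; congr (_ * _)%E.
by rewrite ge0_integral_pushforward ?preimage_setT//; exact: measurable_affine.
Qed.

Lemma ge0_integral_reflect {R : realType} (t : R) (f : R -> \bar R) :
  measurable_fun [set: R] f -> (forall x, 0 <= f x)%E ->
  (\int[lebesgue_measure]_x f (t - x)%R = \int[lebesgue_measure]_x f x)%E.
Proof.
move=> mf f0; rewrite [RHS](@ge0_integral_affine _ (-1) t)// ?oppr_eq0//.
rewrite normrN1 mul1e; apply: eq_integral => x _; congr f; ring.
Qed.

Lemma ge0_integral_shift {R : realType} (t : R) (f : R -> \bar R) :
  measurable_fun [set: R] f -> (forall x, 0 <= f x)%E ->
  (\int[lebesgue_measure]_x f (x - t)%R = \int[lebesgue_measure]_x f x)%E.
Proof.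
move=> mf f0; rewrite [RHS](@ge0_integral_affine _ 1 (- t))// ?oner_eq0//.
by rewrite normr1 mul1e; apply: eq_integral => x _; congr f; rewrite mul1r.
Qed.

(** * The truncated power kernel *)

(** Convolution with [tpow b] is the fractional integral, up to the factor
    1 / Gamma b.  The case b = 1 is the indicator function of the positive
    half-line, which also serves to express bounded ranges of integration. *)
Definition tpow {R : realType} (b v : R) : R := if 0 < v then v `^ (b - 1) else 0.

Section tpow.
Context {R : realType}.
Notation mu := (@lebesgue_measure R).
Implicit Types b c d e l r s t v : R.

Lemma tpow_ge0 b v : 0 <= tpow b v.
Proof. by rewrite /tpow; case: ifP => // _; exact: powR_ge0. Qed.

Lemma tpow_pos b v : 0 < v -> tpow b v = v `^ (b - 1).
Proof. by rewrite /tpow => ->. Qed.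

Lemma tpow_nonpos b v : v <= 0 -> tpow b v = 0.
Proof. by rewrite /tpow leNgt => /negbTE ->. Qed.

Lemma tpow1 v : tpow 1 v = (0 < v)%R%:R.
Proof. by rewrite /tpow subrr powRr0; case: ifP. Qed.

Lemma tpowM b c v : 0 < c -> tpow b (c * v) = c `^ (b - 1) * tpow b v.
Proof.
move=> c0; rewrite /tpow pmulr_rgt0//; case: ifPn => v0; last by rewrite mulr0.
by rewrite powRM// ltW.
Qed.

Lemma measurable_tpow b : measurable_fun [set: R] (tpow b).
Proof.
by apply: measurable_fun_ifT => //; exact: measurable_fun_ltr.
Qed.

Lemma measurable_tpow_sub b t : measurable_fun [set: R] (fun s => tpow b (t - s)).
Proof.
by apply: measurableT_comp; [exact: measurable_tpow|exact: measurable_funB].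
Qed.

End tpow.

Ltac meas :=
  lazymatch goal with
  | |- measurable_fun _ (fun x => EFin _) => apply/measurable_EFinP; meas
  | |- measurable_fun _ (fun x => (_ * _)%R) => apply: measurable_funM; meas
  | |- measurable_fun _ (fun x => (_ - _)%R) => apply: measurable_funB; meas
  | |- measurable_fun _ (fun x => (_ + _)%R) => apply: measurable_funD; meas
  | |- measurable_fun _ (fun x => (- _)%R) =>
      apply: (measurableT_comp (@oppr_measurable _ setT)); meas
  | |- measurable_fun _ (fun x => tpow _ _) =>
      apply: (measurableT_comp (measurable_tpow _)); meas
  | |- measurable_fun _ (fun x => expR _) =>
      apply: (measurableT_comp (@measurable_expR _)); meas
  | |- measurable_fun _ fst => exact: measurable_fst
  | |- measurable_fun _ snd => exact: measurable_snd
  | |- _ => first [ exact: measurable_tpow | exact: mulrl_measurable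
    | exact: oppr_measurable
    | exact: measurable_cst | exact: measurable_id
    | match goal with
      | H : measurable_fun _ _ |- _ => exact: H
      | H : forall _, measurable_fun _ _ |- _ => exact: H
      | H : forall _ _, measurable_fun _ _ |- _ => exact: H
      end
    | apply: measurable_sum; move=> ?; meas
    | idtac ]
  end.

Section tpow_integrals.
Context {R : realType}.
Notation mu := (@lebesgue_measure R).
Implicit Types b c d e l r s t v : R.

Lemma cvg_powR_harmonic b r : 0 < b -> 0 < r ->
  (r / n.+1%:R) `^ b @[n --> \oo] --> 0.
Proof.
move=> b0 r0; have /cvg_at_rightP := powR_cvg0 b0; apply; split.
  by move=> n; rewrite divr_gt0.
rewrite -[X in _ --> X](mulr0 r); apply: cvgMr.
exact: cvg_harmonic.
Qed.

Lemma is_derive_powR_div (b x : R) : b != 0 -> 0 < x ->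
  is_derive x 1 (fun v => v `^ b / b) (x `^ (b - 1)).
Proof.
move=> b0 x0.
have := is_deriveZ b^-1 (is_derive1_powR b x0).
rewrite (_ : b^-1 \*: _ = fun v => v `^ b / b).
  by rewrite /GRing.scale/= mulKf.
by apply/funext => v /=; rewrite /GRing.scale/= mulrC.
Qed.

Lemma integral_powR_itv (b e r : R) : 0 < b -> 0 < e -> e < r ->
  (\int[mu]_(v in `[e, r]) (v `^ (b - 1))%:E = (r `^ b / b - e `^ b / b)%:E)%E.
Proof.
move=> b0 e0 er.
have D (x : R) : 0 < x -> is_derive x 1 (fun v => v `^ b / b) (x `^ (b - 1)).
  by apply: is_derive_powR_div; rewrite gt_eqF.
have gt0 x : e <= x -> 0 < x by exact: lt_le_trans.
have cF x : e <= x -> {for x, continuous (fun v => v `^ b / b)}.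
  move=> /gt0/D dx; apply: differentiable_continuous.
  by apply/derivable1_diffP; case: dx.
rewrite (@continuous_FTC2 _ _ (fun v => v `^ b / b))//.
- apply: derivable_within_continuous => x; rewrite in_itv/= => /andP[/gt0 x0 _].
  by case: (is_derive1_powR (b - 1) x0).
- split.
  + by move=> x; rewrite in_itv/= => /andP[/ltW/gt0/D[]].
  + by apply: cvg_at_right_filter; apply: cF.
  + by apply: cvg_at_left_filter; apply: cF; exact: ltW.
- move=> x; rewrite in_itv/= => /andP[/ltW/gt0 x0 _].
  by rewrite derive1E; have [_ ->] := D _ x0.
Qed.

Lemma bigcup_itv_harmonic r : 0 < r ->
  \bigcup_n `[r / n.+2%:R, r]%classic = `]0, r]%classic.
Proof.
move=> r0; apply/seteqP; split => x /=.
  move=> [n _] /=; rewrite !in_itv/= => /andP[rx ->]; rewrite andbT.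
  by apply: lt_le_trans rx; rewrite divr_gt0.
rewrite in_itv/= => /andP[x0 xr].
exists (Num.truncn (r / x)) => //=; rewrite in_itv/= xr andbT.
rewrite ler_pdivrMr// mulrC -ler_pdivrMr//.
apply: (le_trans (ltW (truncnS_gt _))); by rewrite ler_nat.
Qed.

(** For b < 1 the integrand is unbounded at 0: the fundamental theorem of
    calculus is applied on the intervals [r / (n + 2), r], and then n tends to
    infinity. *)
Lemma integral_tpow_tpow1 b r : 0 < b ->
  (\int[mu]_v (tpow b v * tpow 1 (r - v))%:E = (tpow (b + 1) r / b)%:E)%E.
Proof.
move=> b0; have [r0|r0] := leP r 0.
  rewrite tpow_nonpos// mul0r integral0_eq// => v _.
  rewrite tpow1 subr_gt0; have [vr|] := ltP v r; last by rewrite mulr0.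
  by rewrite tpow_nonpos ?mul0r// (le_trans _ r0)// ltW.
transitivity (\int[mu]_(v in `]0%R, r[) (v `^ (b - 1))%:E)%E.
  rewrite [RHS]integral_mkcond; apply: eq_integral => v _.
  rewrite patchE.
  rewrite tpow1 subr_gt0 /tpow; case: ifPn => v0; case: (ltP v r) => vr/=;
    rewrite ?mulr0 ?mulr1 ?mul0r.
  - by rewrite mem_set//= in_itv/= v0.
  - by rewrite memNset//= in_itv/= (ltNge v r) vr andbF.
  - by rewrite memNset//= in_itv/= (negbTE v0).
  - by rewrite memNset//= in_itv/= (negbTE v0).
rewrite integral_itv_bndo_bndc; last first.
  by apply/measurable_EFinP/measurable_funTS; exact: measurable_powR.
rewrite -bigcup_itv_harmonic//.
pose D n : set R := `[r / n.+2%:R, r]%classic.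
have : (\int[mu]_(v in D n) (v `^ (b - 1))%:E @[n --> \oo] -->
    \int[mu]_(v in \bigcup_n D n) (v `^ (b - 1))%:E)%E.
  apply: ge0_nondecreasing_set_cvg_integral.
  - apply/nondecreasing_seqP => n; rewrite subsetEset => x; rewrite /D/=.
    rewrite !in_itv/= => /andP[rx ->]; rewrite andbT (le_trans _ rx)//.
    by rewrite ler_pM2l// lef_pV2 ?posrE// ler_nat.
  - by move=> n; exact: measurable_itv.
  - by move=> n; apply/measurable_EFinP/measurable_funTS; exact: measurable_powR.
  - by move=> n x _; rewrite lee_fin powR_ge0.
under eq_fun => n.
  rewrite /D integral_powR_itv ?divr_gt0//; last first.
    by rewrite ltr_pdivrMr// ltr_pMr// ltr1n.
  over.
move=> h; apply: (cvg_unique _ h).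
  exact: ereal_hausdorff.
apply: cvg_EFin; first exact: nearW.
rewrite tpow_pos// addrK -[X in _ --> X]subr0; apply: cvgB; first exact: cvg_cst.
rewrite -(mul0r b^-1); apply: cvgMl.
by have := cvg_powR_harmonic b0 r0; rewrite -cvg_shiftS.
Qed.

Lemma integral_expR_tpow1 l : 0 < l ->
  (\int[mu]_v (expR (- (l * v)) * tpow 1 v)%:E = (l^-1)%:E)%E.
Proof.
move=> l0; have l'0 : 0 <= l^-1 by rewrite invr_ge0 ltW.
have mE : measurable_fun [set: R] (fun v => expR (- (l * v))).
  by apply: measurableT_comp => //; apply: measurableT_comp => //;
    exact: measurable_funM.
transitivity (\int[mu]_(v in `]0%R, +oo[) (expR (- (l * v)))%:E)%E.
  rewrite [RHS]integral_mkcond; apply: eq_integral => v _.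
  rewrite patchE tpow1; case: ifPn.
    by rewrite inE/= in_itv/= andbT => ->; rewrite mulr1.
  by rewrite notin_setE/= in_itv/= andbT => /negP/negbTE ->; rewrite mulr0.
rewrite integral_itv_obnd_cbnd; last exact/measurable_EFinP/measurable_funTS.
transitivity (\int[mu]_(v in `[0%R, +oo[) (l^-1 * (l * expR (- l * v)))%:E)%E.
  by apply: eq_integral => v _; rewrite mulKf ?gt_eqF// mulNr.
under eq_integral do rewrite EFinM.
rewrite ge0_integralZl_EFin//.
- rewrite (_ : (\int[_]_(_ in _) _)%E = 1%E) ?mule1//.
  rewrite -[RHS](integral_exponential_pdf l0) [LHS]integral_mkcond.
  by apply: eq_integral => v _; rewrite restrict_EFin.
- by move=> v _; rewrite lee_fin mulr_ge0 ?expR_ge0// ltW.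
- apply/measurable_EFinP/measurable_funTS/measurable_funM => //.
  by apply: measurableT_comp => //; exact: measurable_funM.
Qed.

(** The singular power is kept below d and bounded by its value at d above.
    Integrated against e^(-l v), whose mass is 1 / l, this produces the constant
    d^b / b + d^(b-1) / l of the bounds that follow, which is small when d is
    small and l is large. *)
Lemma tpow_le_split b d v : b <= 1 -> 0 < d ->
  tpow b v <= tpow b v * tpow 1 (d - v) + d `^ (b - 1).
Proof.
move=> b1 d0; rewrite tpow1 subr_gt0; have [vd|dv] := ltP v d.
  by rewrite mulr1 lerDl powR_ge0.
rewrite mulr0 add0r tpow_pos ?(lt_le_trans d0)//.
by rewrite -opprB !powRN lef_pV2 ?posrE ?powR_gt0 ?(lt_le_trans d0)//;
  rewrite ge0_ler_powR ?nnegrE ?subr_ge0 ?(ltW d0) ?(le_trans (ltW d0)).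
Qed.

(** The map phi is the identity or a reflection v |-> r - v.  The hypothesis on
    it says that the singularity of the kernel, wherever it lies, costs no more
    than the integral of v^(b-1) over [0, d]. *)
Lemma le_integral_tpow_expR (b l d : R) (phi : R -> R) : 0 < b -> b <= 1 ->
  0 < l -> 0 < d -> measurable_fun setT phi ->
  (\int[mu]_v (tpow b (phi v) * tpow 1 (d - phi v))%:E <= (d `^ b / b)%:E)%E ->
  (\int[mu]_v (tpow b (phi v) * (expR (- (l * v)) * tpow 1 v))%:E <=
   (d `^ b / b + d `^ (b - 1) / l)%:E)%E.
Proof.
move=> b0 b1 l0 d0 mphi hphi.
have mE : measurable_fun [set: R] (fun v => expR (- (l * v)) * tpow 1 v).
  apply: measurable_funM; last exact: measurable_tpow.
  by apply: measurableT_comp => //; apply: measurableT_comp => //;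
    exact: measurable_funM.
have mt c : measurable_fun [set: R] (fun v => tpow c (phi v)).
  by apply: measurableT_comp; [exact: measurable_tpow|].
have mt' c : measurable_fun [set: R] (fun v => tpow c (d - phi v)).
  by apply: measurableT_comp; [exact: measurable_tpow|exact: measurable_funB].
have E0 v : 0 <= expR (- (l * v)) * tpow 1 v.
  by rewrite mulr_ge0 ?expR_ge0 ?tpow_ge0.
have E1 v : expR (- (l * v)) * tpow 1 v <= 1.
  rewrite tpow1; case: ltP => v0; last by rewrite mulr0.
  by rewrite mulr1 expR_le1 oppr_le0 mulr_ge0// ltW.
have -> : (d `^ b / b + d `^ (b - 1) / l)%:E = ((d `^ b / b)%:E +
    \int[mu]_v (d `^ (b - 1) * (expR (- (l * v)) * tpow 1 v))%:E)%E.
  under [in RHS]eq_integral do rewrite EFinM.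
  rewrite ge0_integralZl_EFin ?powR_ge0//.
  - by rewrite integral_expR_tpow1.
  - by move=> v _; rewrite lee_fin.
  - exact/measurable_EFinP.
apply: le_trans (leeD hphi (le_refl _)).
rewrite -ge0_integralD//; last 4 first.
- by move=> v _; rewrite lee_fin mulr_ge0 ?tpow_ge0.
- meas.
- by move=> v _; rewrite lee_fin mulr_ge0 ?powR_ge0.
- meas.
apply: ge0_le_integral => //.
- by move=> v _; rewrite lee_fin mulr_ge0 ?tpow_ge0.
- meas.
- by apply: emeasurable_funD; meas.
move=> v _; rewrite -EFinD lee_fin.
apply: (le_trans (ler_wpM2r (E0 v) (tpow_le_split (phi v) b1 d0))).
rewrite mulrDl lerD2r ler_piMr// mulr_ge0 ?tpow_ge0//.
Qed.

Lemma le_integral_tpow_expRl b l d : 0 < b -> b <= 1 -> 0 < l -> 0 < d ->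
  (\int[mu]_v (tpow b v * expR (- (l * v)))%:E <=
   (d `^ b / b + d `^ (b - 1) / l)%:E)%E.
Proof.
move=> b0 b1 l0 d0.
have := @le_integral_tpow_expR b l d id b0 b1 l0 d0.
rewrite integral_tpow_tpow1// tpow_pos// addrK => h.
apply: le_trans (h _ _) => //; rewrite le_eqVlt; apply/orP; left; apply/eqP.
apply: eq_integral => v _; rewrite tpow1; congr EFin.
by case: ltP => v0; rewrite ?mulr1// tpow_nonpos// !mul0r.
Qed.

Lemma le_integral_tpow_expRr b l d r : 0 < b -> b <= 1 -> 0 < l -> 0 < d ->
  (\int[mu]_v (tpow b (r - v) * (expR (- (l * v)) * tpow 1 v))%:E <=
   (d `^ b / b + d `^ (b - 1) / l)%:E)%E.
Proof.
move=> b0 b1 l0 d0; apply: le_integral_tpow_expR => //.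
  exact: measurable_funB.
rewrite (@ge0_integral_reflect _ r (fun v => (tpow b v * tpow 1 (d - v))%:E)).
- by rewrite integral_tpow_tpow1// tpow_pos// addrK.
- apply/measurable_EFinP/measurable_funM; first exact: measurable_tpow.
  exact: measurable_tpow_sub.
- by move=> v; rewrite lee_fin mulr_ge0 ?tpow_ge0.
Qed.

(** [Gamma] is a real-valued integral, which would be 0 if the extended one were
    infinite.  So the point of this equation is finiteness, and that comes from
    the preceding bound with l = d = 1. *)
Lemma Gamma_tpow b : 0 < b -> b <= 1 ->
  (\int[mu]_v (tpow b v * expR (- v))%:E = (Gamma b)%:E)%E.
Proof.
move=> b0 b1; rewrite /Gamma /Rintegral fineK.
  rewrite [RHS]integral_mkcond; apply: eq_integral => v _.
  rewrite patchE; case: ifPn.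
    by rewrite inE/= in_itv/= andbT => v0; rewrite tpow_pos.
  by rewrite notin_setE/= in_itv/= andbT => /negP; rewrite -leNgt => v0;
    rewrite tpow_nonpos// mul0r.
rewrite ge0_fin_numE; last first.
  by apply: integral_ge0 => v _; rewrite lee_fin mulr_ge0 ?expR_ge0 ?powR_ge0.
apply: le_lt_trans (ltry (1 `^ b / b + 1 `^ (b - 1) / 1)).
apply: le_trans (@le_integral_tpow_expRl b 1 1 b0 b1 ltr01 ltr01).
rewrite integral_mkcond le_eqVlt; apply/orP; left; apply/eqP.
apply: eq_integral => v _; rewrite patchE mul1r; case: ifPn.
  by rewrite inE/= in_itv/= andbT => v0; rewrite tpow_pos.
by rewrite notin_setE/= in_itv/= andbT => /negP; rewrite -leNgt => v0;
  rewrite tpow_nonpos// mul0r.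
Qed.

(** On ]0, 1[ the integrand is at least e^(-1), as v^(b-1) >= 1 there. *)
Lemma Gamma_gt0 b : 0 < b -> b <= 1 -> 0 < Gamma b.
Proof.
move=> b0 b1; rewrite -lte_fin -Gamma_tpow//.
apply: (@lt_le_trans _ _ (expR (- 1))%:E); first by rewrite lte_fin expR_gt0.
have -> : ((expR (- 1))%:E =
    \int[mu]_v (expR (- 1) * (tpow 1 v * tpow 1 (1 - v)))%:E)%E.
  under [in RHS]eq_integral do rewrite EFinM.
  rewrite ge0_integralZl_EFin ?expR_ge0//.
  - rewrite integral_tpow_tpow1// tpow_pos// powR1 divr1 -EFinM.
    by rewrite mulr1.
  - by move=> v _; rewrite lee_fin mulr_ge0 ?tpow_ge0.
  - meas.
apply: ge0_le_integral => //.
- by move=> v _; rewrite lee_fin !mulr_ge0 ?expR_ge0 ?tpow_ge0.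
- meas.
- meas.
move=> v _; rewrite lee_fin !tpow1 subr_gt0.
case: (ltP 0 v) => v0; last first.
  by rewrite mul0r mulr0 mulr_ge0 ?expR_ge0 ?tpow_ge0.
case: (ltP v 1) => v1; last first.
  by rewrite !mulr0 mulr_ge0 ?expR_ge0 ?tpow_ge0.
rewrite !mulr1 -[leLHS]mul1r ler_pM ?expR_ge0//.
  rewrite tpow_pos// -[leLHS](powRr0 v) ger_powR ?subr_le0//.
  by rewrite v0 ltW.
by rewrite ler_expR lerN2 ltW.
Qed.

Lemma integral_tpow_conv_shift b c r t :
  (\int[mu]_s (tpow b (t - s) * tpow c (s - r))%:E =
   \int[mu]_v (tpow b (t - r - v) * tpow c v)%:E)%E.
Proof.
rewrite -(@ge0_integral_shift _ r (fun v => (tpow b (t - r - v) * tpow c v)%:E)).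
- by apply: eq_integral => s _; rewrite opprB addrA subrK.
- meas.
- by move=> v; rewrite lee_fin mulr_ge0 ?tpow_ge0.
Qed.

Lemma integral_tpow_conv_tpow1 b r t : 0 < b ->
  (\int[mu]_s (tpow b (t - s) * tpow 1 (s - r))%:E =
   (tpow (b + 1) (t - r) / b)%:E)%E.
Proof.
move=> b0; rewrite -(@integral_tpow_tpow1 b (t - r) b0).
rewrite -(@ge0_integral_reflect _ t (fun v => (tpow b v * tpow 1 (t - r - v))%:E)).
- by apply: eq_integral => s _; congr (_ * tpow _ _)%:E; ring.
- meas.
- by move=> v; rewrite lee_fin mulr_ge0 ?tpow_ge0.
Qed.

(** For b + c = 1 the integrand is homogeneous of degree -1, which cancels the
    Jacobian of the dilation by r. *)
Let beta_scale b c r : b + c = 1 -> 0 < r ->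
  (\int[mu]_v (tpow b (r - v) * tpow c v)%:E =
   \int[mu]_v (tpow b (1 - v) * tpow c v)%:E)%E.
Proof.
move=> bc r0; rewrite (@ge0_integral_affine _ r 0) ?gt_eqF//; last 2 first.
- meas.
- by move=> v; rewrite lee_fin mulr_ge0 ?tpow_ge0.
rewrite -ge0_integralZl_EFin//; last 2 first.
- by move=> v _; rewrite lee_fin mulr_ge0 ?tpow_ge0.
- meas.
apply: eq_integral => v _; rewrite -EFinM; congr EFin.
rewrite addr0 (_ : r - r * v = r * (1 - v)); last by rewrite mulrBr mulr1.
rewrite !tpowM// gtr0_norm// mulrACA mulrA -powRD; last first.
  by rewrite (gt_eqF r0) implybT.
rewrite (_ : b - 1 + (c - 1) = - 1); last by lra.
by rewrite powR_inv1 ?ltW// !mulrA divff ?gt_eqF// mul1r.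
Qed.

(** By [beta_scale], the integral has the same value B for all r > 0.  Hence its
    integral against e^(-r) over r > 0 is B.  By Tonelli and
    e^(-r) = e^(-(r-v)) e^(-v), the same double integral factors as the product
    of the two Gamma integrals. *)
Lemma beta_tpow b c r : 0 < b -> 0 < c -> b + c = 1 ->
  (\int[mu]_v (tpow b (r - v) * tpow c v)%:E =
   (Gamma b * Gamma c * tpow 1 r)%:E)%E.
Proof.
move=> b0 c0 bc; have [r0|r0] := leP r 0.
  rewrite (tpow_nonpos _ r0) mulr0 integral0_eq// => v _.
  have [v0|v0] := leP v 0; first by rewrite (tpow_nonpos _ v0) mulr0.
  by rewrite tpow_nonpos ?mul0r// subr_le0 (le_trans r0)// ltW.
rewrite tpow1 r0 mulr1 beta_scale//.
have b1 : b <= 1 by rewrite -bc lerDl ltW.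
have c1 : c <= 1 by rewrite -bc lerDr ltW.
pose B : \bar R := (\int[mu]_v (tpow b (1 - v) * tpow c v)%:E)%E.
have B0 : (0 <= B)%E.
  by apply: integral_ge0 => v _; rewrite lee_fin mulr_ge0 ?tpow_ge0.
rewrite -/B.
transitivity (\int[mu]_s ((expR (- s) * tpow 1 s)%:E * B))%E.
  rewrite ge0_integralZr//.
  - rewrite [X in (X * _)%E](_ : _ = 1%E) ?mul1e//.
    have := integral_expR_tpow1 (@ltr01 R); rewrite invr1 => <-.
    by apply: eq_integral => v _; rewrite mul1r.
  - meas.
  - by move=> s _; rewrite lee_fin mulr_ge0 ?expR_ge0 ?tpow_ge0.
pose f (z : R * R) := (expR (- z.1) * (tpow b (z.1 - z.2) * tpow c z.2))%:E.
have f0 z : (0 <= f z)%E.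
  by rewrite lee_fin !mulr_ge0 ?expR_ge0 ?tpow_ge0.
have mf : measurable_fun setT f by rewrite /f; meas.
transitivity (\int[mu]_s \int[mu]_v f (s, v))%E.
  apply: eq_integral => s _; rewrite /f/=.
  under [in RHS]eq_integral do rewrite EFinM.
  rewrite ge0_integralZl_EFin; last 4 first.
  - exact: measurableT.
  - by move=> v _; rewrite lee_fin mulr_ge0 ?tpow_ge0.
  - clear mf; meas.
  - exact: expR_ge0.
  rewrite EFinM -muleA; congr (_ * _)%E.
  have [s0|s0] := leP s 0; last first.
    by rewrite tpow1 s0 mul1e beta_scale.
  rewrite tpow_nonpos// mul0e integral0_eq// => v _.
  have [v0|v0] := leP v 0; first by rewrite (tpow_nonpos _ v0) mulr0.
  by rewrite tpow_nonpos ?mul0r// subr_le0 (le_trans s0)// ltW.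
rewrite (@fubini_tonelli _ _ _ _ R mu mu f mf f0).
transitivity (\int[mu]_v ((tpow c v * expR (- v))%:E * (Gamma b)%:E))%E.
  apply: eq_integral => v _; rewrite /f/= -Gamma_tpow//.
  rewrite -(@ge0_integral_shift _ v); last 2 first.
  - meas.
  - by move=> w; rewrite lee_fin mulr_ge0 ?expR_ge0 ?tpow_ge0.
  rewrite -ge0_integralZl_EFin; last 4 first.
  - by [].
  - by move=> w _; rewrite lee_fin mulr_ge0 ?expR_ge0 ?tpow_ge0.
  - meas.
  - by rewrite mulr_ge0 ?expR_ge0 ?tpow_ge0.
  apply: eq_integral => w _; rewrite -EFinM; congr EFin.
  rewrite (_ : - w = - v + - (w - v)) ?expRD; last by ring.
  ring.
rewrite ge0_integralZr//.
- by rewrite (Gamma_tpow c0 c1) -EFinM mulrC.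
- meas.
- by move=> v _; rewrite lee_fin mulr_ge0 ?expR_ge0 ?tpow_ge0.
- by rewrite lee_fin ltW// Gamma_gt0.
Qed.

Lemma le_integral_tpow_expR_weight b l d t : 0 < b -> b <= 1 -> 0 < l -> 0 < d ->
  (\int[mu]_s (tpow b (t - s) * expR (l * s))%:E <=
   ((d `^ b / b + d `^ (b - 1) / l) * expR (l * t))%:E)%E.
Proof.
move=> b0 b1 l0 d0; rewrite mulrC EFinM.
apply: (@le_trans _ _ ((expR (l * t))%:E *
    \int[mu]_v (tpow b v * expR (- (l * v)))%:E)%E); last first.
  by rewrite lee_pmul2l ?lte_fin ?expR_gt0// le_integral_tpow_expRl.
rewrite -ge0_integralZl_EFin ?expR_ge0//; last 2 first.
- by move=> v _; rewrite lee_fin mulr_ge0 ?tpow_ge0 ?expR_ge0.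
- meas.
rewrite -(@ge0_integral_reflect _ t); last 2 first.
- meas.
- by move=> v; rewrite lee_fin mulr_ge0 ?tpow_ge0 ?expR_ge0.
rewrite le_eqVlt; apply/orP; left; apply/eqP.
apply: eq_integral => v _; rewrite -EFinM; congr EFin.
rewrite (_ : t - (t - v) = v); last by ring.
rewrite (_ : l * (t - v) = l * t - l * v); last by ring.
by rewrite expRD; ring.
Qed.

(** The larger of x and y is at least their mean, and v^(b-1)
    is nonincreasing in v. *)
Lemma tpowM_le b x y : b <= 1 ->
  tpow b x * tpow b y <=
  ((x + y) / 2) `^ (b - 1) * (tpow b x * tpow 1 y + tpow b y * tpow 1 x).
Proof.
move=> b1.
have sym : forall x y : R, 0 < x -> 0 < y -> x <= y ->
    tpow b x * tpow b y <=
    ((x + y) / 2) `^ (b - 1) * (tpow b x * tpow 1 y + tpow b y * tpow 1 x).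
  move=> {}x {}y x0 y0 xy; rewrite !tpow1 x0 y0 !mulr1.
  rewrite mulrDr -[leLHS]addr0; apply: lerD.
    2: by rewrite mulr_ge0 ?powR_ge0 ?tpow_ge0.
  rewrite mulrC ler_wpM2r ?tpow_ge0// tpow_pos//.
  rewrite -opprB !powRN lef_pV2 ?posrE ?powR_gt0//; last by lra.
  by rewrite ge0_ler_powR ?nnegrE; lra.
have rhs0 : 0 <=
    ((x + y) / 2) `^ (b - 1) * (tpow b x * tpow 1 y + tpow b y * tpow 1 x).
  by rewrite mulr_ge0 ?powR_ge0// addr_ge0// mulr_ge0 ?tpow_ge0.
have [x0|x0] := leP x 0; first by rewrite {1}(tpow_nonpos _ x0) mul0r.
have [y0|y0] := leP y 0; first by rewrite {1}(tpow_nonpos _ y0) mulr0.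
have [xy|/ltW yx] := leP x y; first exact: sym.
by rewrite mulrC addrC (addrC (tpow b x * _)) sym.
Qed.

(** The arguments t - s and s - r of the two kernels have the constant sum
    t - r.  Therefore [tpowM_le] replaces the product of the kernels by their
    sum, up to the factor ((t - r) / 2)^(b-1), and leaves integrals with a
    single kernel. *)
Lemma le_integral_tpow_tpow_weight b l d r t :
  0 < b -> b <= 1 -> 0 < l -> 0 < d ->
  (\int[mu]_s (tpow b (t - s) * (tpow b (s - r) * expR (l * (s - r))))%:E <=
   (2 `^ (1 - b) * (2 * (d `^ b / b + d `^ (b - 1) / l)) *
    (tpow b (t - r) * expR (l * (t - r))))%:E)%E.
Proof.
move=> b0 b1 l0 d0; set e := d `^ b / b + _.
have [tr|rt] := leP t r.
  rewrite (@tpow_nonpos _ b (t - r)) ?subr_le0// mul0r mulr0.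
  rewrite integral0_eq// => s _.
  have [sr|rs] := leP s r.
    by rewrite (@tpow_nonpos _ b (s - r)) ?subr_le0// mul0r mulr0.
  by rewrite tpow_nonpos ?mul0r// subr_le0 (le_trans tr)// ltW.
pose q := t - r; have q0 : 0 < q by rewrite subr_gt0.
pose C := (q / 2) `^ (b - 1) * expR (l * q).
have C0 : 0 <= C by rewrite mulr_ge0 ?powR_ge0 ?expR_ge0.
have -> : (2 `^ (1 - b) * (2 * e) * (tpow b (t - r) * expR (l * (t - r))))%:E =
    (C%:E * (e%:E + e%:E))%E.
  rewrite -EFinD -EFinM; congr EFin; rewrite /C tpow_pos ?subr_gt0// -/q.
  rewrite powRM ?invr_ge0 ?ltW// -(powR_inv1 (@ler0n R 2)) -powRrM.
  rewrite (_ : -1 * (b - 1) = 1 - b); last by ring.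
  by ring.
rewrite -(@ge0_integral_reflect _ t); last 2 first.
- meas.
- by move=> s; rewrite lee_fin !mulr_ge0 ?tpow_ge0 ?expR_ge0.
apply: (@le_trans _ _ (C%:E * (\int[mu]_v (tpow b v * expR (- (l * v)))%:E +
   \int[mu]_v (tpow b (q - v) * (expR (- (l * v)) * tpow 1 v))%:E))%E); last first.
  rewrite lee_pmul2l// ?lte_fin ?mulr_gt0 ?powR_gt0 ?expR_gt0 ?divr_gt0//.
  by apply: leeD; [exact: le_integral_tpow_expRl|exact: le_integral_tpow_expRr].
rewrite -ge0_integralD//; last 4 first.
- by move=> s _; rewrite lee_fin !mulr_ge0 ?tpow_ge0 ?expR_ge0.
- meas.
- by move=> s _; rewrite lee_fin !mulr_ge0 ?tpow_ge0 ?expR_ge0.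
- meas.
rewrite -ge0_integralZl_EFin//; last 2 first.
- by move=> s _; rewrite -EFinD lee_fin addr_ge0// !mulr_ge0 ?tpow_ge0 ?expR_ge0.
- by apply: emeasurable_funD; meas.
apply: ge0_le_integral => //.
- by move=> s _; rewrite lee_fin !mulr_ge0 ?tpow_ge0 ?expR_ge0.
- meas.
- by apply: measurable_funeM; apply: emeasurable_funD; meas.
move=> v _; rewrite -EFinD -EFinM lee_fin.
rewrite (_ : t - (t - v) = v); last by ring.
rewrite (_ : t - v - r = q - v); last by rewrite /q; ring.
rewrite (_ : l * (q - v) = l * q - l * v); last by ring.
rewrite expRD mulrA.
apply: le_trans (ler_wpM2r _ (tpowM_le v (q - v) b1)) _.
  by rewrite mulr_ge0 ?expR_ge0.
rewrite (_ : v + (q - v) = q); last by ring.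
rewrite -subr_ge0 /C.
rewrite (_ : _ - _ = (q / 2) `^ (b - 1) * expR (l * q) *
  (tpow b v * expR (- (l * v))) * (1 - tpow 1 (q - v))); last by ring.
rewrite !mulr_ge0 ?powR_ge0 ?expR_ge0 ?tpow_ge0// subr_ge0 tpow1.
by case: (_ < _).
Qed.

(** The number d makes the first term equal to e / 2, then l the second. *)
Lemma exists_small_weight b e : 0 < b -> 0 < e ->
  exists l d : R, [/\ 0 < l, 0 < d & d `^ b / b + d `^ (b - 1) / l <= e].
Proof.
move=> b0 e0; pose d := (b * e / 2) `^ b^-1.
have d0 : 0 < d by rewrite powR_gt0// divr_gt0 ?mulr_gt0.
have D0 : 0 < d `^ (b - 1) by rewrite powR_gt0.
exists (2 * d `^ (b - 1) / e), d; split => //.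
  by rewrite divr_gt0// mulr_gt0.
have -> : d `^ b = b * e / 2.
  by rewrite /d -powRrM mulVf ?gt_eqF// powRr1// divr_ge0// mulr_ge0 ?ltW.
rewrite le_eqVlt; apply/orP; left; apply/eqP; field.
by rewrite !gt_eqF.
Qed.
End tpow_integrals.

(** * Integrals depending on a parameter *)

Section integral_tools.
Context {R : realType}.
Notation mu := (@lebesgue_measure R).

Lemma dominated_Rintegral (g G : R -> R) (c : R) :
  measurable_fun setT g -> measurable_fun setT G ->
  (forall s, `|g s| <= G s) -> (\int[mu]_s (G s)%:E <= c%:E)%E ->
  mu.-integrable setT (EFin \o g) /\ `|\int[mu]_s g s| <= c.
Proof.
move=> mg mG gG Gc.
have Gi : mu.-integrable setT (EFin \o G).
  apply/integrableP; split; first exact/measurable_EFinP.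
  apply: le_lt_trans (ltry c); apply: le_trans Gc.
  rewrite le_eqVlt; apply/orP; left; apply/eqP; apply: eq_integral => s _ /=.
  by rewrite ger0_norm// (le_trans _ (gG s)).
have gi : mu.-integrable setT (EFin \o g).
  apply: le_integrable Gi => //; first exact/measurable_EFinP.
  by move=> s _ /=; rewrite lee_fin (le_trans (gG s))// ler_norm.
split => //; apply: (le_trans (le_normr_Rintegral _ gi)) => //.
apply: (@le_trans _ _ (\int[mu]_s G s)).
  apply: le_Rintegral => //; first exact: integrable_norm.
by rewrite -lee_fin /Rintegral fineK// integrable_fin_num.
Qed.

Lemma measurable_Rintegral_param d (P : measurableType d) (h : P -> R -> R) :
  measurable_fun setT (fun z : P * R => h z.1 z.2) ->
  measurable_fun setT (fun p => \int[mu]_s h p s).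
Proof.
move=> mh; pose f (z : P * R) := (h z.1 z.2)%:E.
have mf : measurable_fun setT f by apply/measurable_EFinP.
apply: (@measurable_comp _ _ _ _ _ _ setT fine) => //.
pose Fp p := (\int[mu]_y f^\+ (p, y))%E.
pose Fm p := (\int[mu]_y f^\- (p, y))%E.
rewrite [X in measurable_fun _ X](_ : _ = (fun p => Fp p - Fm p)%E).
  apply: emeasurable_funB.
    apply: measurable_fun_fubini_tonelli_F => //.
    exact: measurable_funepos.
  apply: measurable_fun_fubini_tonelli_F => //.
  exact: measurable_funeneg.
apply/funext => p; rewrite integralE /Fp /Fm; congr (_ - _)%E;
  by apply: eq_integral => y _; rewrite ?funeposE ?funenegE.
Qed.

Lemma RFubini (h : R -> R -> R) :
  measurable_fun setT (fun z : R * R => h z.1 z.2) ->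
  (forall x, mu.-integrable setT (fun y => (h x y)%:E)) ->
  (forall y, mu.-integrable setT (fun x => (h x y)%:E)) ->
  (\int[mu]_y \int[mu]_x `|h x y|%:E < +oo)%E ->
  \int[mu]_x \int[mu]_y h x y = \int[mu]_y \int[mu]_x h x y.
Proof.
move=> mh h1 h2 hoo; pose f (z : R * R) := (h z.1 z.2)%:E.
have mf : measurable_fun setT f by apply/measurable_EFinP.
have fi : (mu \x mu)%E.-integrable setT f.
  exact: (proj2 (@integrable21ltyP _ _ _ _ R mu mu f mf) hoo).
have := Fubini fi; rewrite /f/= => E.
rewrite /Rintegral; congr fine; transitivity (\int[mu]_x \int[mu]_y (h x y)%:E)%E.
  by apply: eq_integral => x _; rewrite fineK// integrable_fin_num.
by rewrite E; apply: eq_integral => y _; rewrite fineK// integrable_fin_num.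
Qed.

Lemma Rintegral_dominated_cvg (h : nat -> R -> R) (g G : R -> R) :
  (forall N, measurable_fun setT (h N)) ->
  mu.-integrable setT (EFin \o G) ->
  (forall N s, `|h N s| <= G s) ->
  (forall s, h N s @[N --> \oo] --> g s) ->
  \int[mu]_s h N s @[N --> \oo] --> \int[mu]_s g s.
Proof.
move=> mh iG hG hg.
have mh' N : measurable_fun setT (EFin \o h N) by exact/measurable_EFinP.
have hg' s : (EFin \o h N) s @[N --> \oo] --> (EFin \o g) s.
  by apply: cvg_EFin; [exact: nearW|exact: hg].
have mg : measurable_fun setT (EFin \o g).
  apply/measurable_EFinP; apply: (measurable_fun_cvg mh) => // s _.
have [|||ig _ cv] := @dominated_convergence _ _ _ mu _ measurableT
    (fun N => EFin \o h N) (EFin \o g) (EFin \o G) mh' mg.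
- by apply: aeW => s _; exact: hg'.
- exact: iG.
- by apply: aeW => s N _; rewrite lee_fin.
by apply: fine_cvg; rewrite fineK ?integrable_fin_num.
Qed.

Lemma cvg_series_half (u : R^nat) (C : R) : (forall m, `|u m| <= C * 2^-1 ^+ m) ->
  cvgn (series u) /\ forall N, `|series u N| <= 2 * C.
Proof.
move=> uC.
have half : `|2^-1 : R| < 1 by rewrite ger0_norm; lra.
have C0 : 0 <= C by have := uC 0; rewrite expr0 mulr1; exact: le_trans.
split.
  apply: normed_cvg; apply: (series_le_cvg _ _ uC) => //.
  - by move=> m; rewrite mulr_ge0// exprn_ge0.
  - exact: is_cvg_geometric_series.
move=> N; apply: (@le_trans _ _ (series (geometric C 2^-1) N)).
  by apply: (le_trans (ler_norm_sum _ _ _)); apply: ler_sum => m _.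
apply: le_trans (geometric_le_lim N C0 _ half) _ => //.
by rewrite le_eqVlt; apply/orP; left; apply/eqP; field.
Qed.

Lemma Rintegral_lincomb (m : nat) (g : 'I_m -> R -> R) (c : 'I_m -> R) (x : R) :
  (forall j, mu.-integrable setT (EFin \o g j)) ->
  \int[mu]_s (x * \sum_j c j * g j s) = x * \sum_j c j * \int[mu]_s g j s.
Proof.
move=> gi.
have gci j : mu.-integrable setT (fun s => (c j * g j s)%:E).
  exact: (integrableZl measurableT (c j) (gi j)).
have gsi : mu.-integrable setT (fun s => (\sum_j c j * g j s)%:E).
  under eq_fun do rewrite -sumEFin; exact: integrable_sum.
rewrite RintegralZl//; congr (_ * _).
rewrite {1}/Rintegral; under eq_integral do rewrite -sumEFin.
rewrite integral_sum//.
under eq_bigr => j _.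
  rewrite -(fineK (integrable_fin_num measurableT (gci j))).
  rewrite -/(Rintegral mu setT (fun s => c j * g j s)) RintegralZl//.
  over.
by rewrite sumEFin.
Qed.

Lemma Rintegral_tpow_causal (b c : R) (g : R -> R) (t : R) : (forall s, s < c -> g s = 0) ->
  t <= c -> \int[mu]_s (tpow b (t - s) * g s) = 0.
Proof.
move=> g0 tc.
transitivity (\int[mu]_(x in [set: R]) (0 : R)); last first.
  by rewrite /Rintegral integral0.
apply: eq_Rintegral => s _; have [st|ts] := ltP s t; last first.
  by rewrite tpow_nonpos ?mul0r// subr_le0.
by rewrite g0 ?mulr0// (lt_le_trans st).
Qed.

End integral_tools.

(** * Neumann series of the Volterra operator *)

(** This is J^a (A f), for a vector function f given by its entries. *)
Definition volt {R : realType} {n : nat} (a : R) (A : R -> 'M[R]_n)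
    (f : 'I_n -> R -> R) (i : 'I_n) (t : R) : R :=
  (Gamma a)^-1 *
  \int[lebesgue_measure]_s (tpow a (t - s) * \sum_l A s i l * f l s).

(** In the norm sup |f| / w, the convolution with [tpow a] has norm at most
    k. *)
Record weight {R : realType} (a k : R) (w : R -> R) : Prop := Weight {
  weight_ge0 : forall s, 0 <= w s ;
  measurable_weight : measurable_fun setT w ;
  weight_le : forall t, (\int[lebesgue_measure]_s (tpow a (t - s) * w s)%:E
                         <= (k * w t)%:E)%E }.

Section volt.
Context {R : realType} {n : nat}.
Notation mu := (@lebesgue_measure R).
Variables (a M : R) (A : R -> 'M[R]_n).
Hypotheses (a_gt0 : 0 < a) (a_le1 : a <= 1).
Hypothesis mA : forall i j, measurable_fun setT (fun s => A s i j).
Hypothesis AM : forall s i j, `|A s i j| <= M.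
Implicit Types (f : 'I_n -> R -> R) (k q c t s : R).

Let M_ge0 (i : 'I_n) : 0 <= M.
Proof. exact: le_trans (AM 0 i i). Qed.

Let Gamma_inv_ge0 : 0 <= (Gamma a)^-1.
Proof. by rewrite invr_ge0 ltW// Gamma_gt0. Qed.

Lemma weight_dominated k w (g : R -> R) c t : weight a k w -> 0 <= c ->
  measurable_fun setT g -> (forall s, `|g s| <= c * w s) ->
  mu.-integrable setT (fun s => (tpow a (t - s) * g s)%:E) /\
  `|\int[mu]_s (tpow a (t - s) * g s)| <= c * (k * w t).
Proof.
move=> ww c0 mg gw; have mw := measurable_weight ww.
apply: (@dominated_Rintegral _ _ (fun s => c * (tpow a (t - s) * w s))).
- meas.
- meas.
- move=> s; rewrite normrM (ger0_norm (tpow_ge0 _ _)) mulrCA.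
  by rewrite ler_wpM2l ?tpow_ge0.
- under eq_integral do rewrite EFinM.
  rewrite ge0_integralZl_EFin//; last 2 first.
  + by move=> s _; rewrite lee_fin mulr_ge0 ?tpow_ge0 ?(weight_ge0 ww).
  + meas.
  by rewrite EFinM lee_wpmul2l ?lee_fin// (weight_le ww).
Qed.

Lemma sum_dominated w f i c : (forall l s, `|f l s| <= c * w s) ->
  forall s, `|\sum_l A s i l * f l s| <= n%:R * M * c * w s.
Proof.
move=> fw s; apply: (le_trans (ler_norm_sum _ _ _)).
apply: (@le_trans _ _ (\sum_(l < n) M * (c * w s))).
  by apply: ler_sum => l _; rewrite normrM ler_pM.
by rewrite sumr_const card_ord -[_ *+ n]mulr_natl !mulrA.
Qed.

Lemma volt_bound k w f i c t : weight a k w -> 0 <= c ->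
  (forall l, measurable_fun setT (f l)) -> (forall l s, `|f l s| <= c * w s) ->
  `|volt a A f i t| <= c * ((n%:R * M * k / Gamma a) * w t).
Proof.
move=> ww c0 mf fw; have M0 := M_ge0 i.
have c'0 : 0 <= n%:R * M * c by rewrite !mulr_ge0.
have mS : measurable_fun setT (fun s => \sum_l A s i l * f l s) by meas.
have [_ h] := weight_dominated t ww c'0 mS (sum_dominated i fw).
rewrite /volt normrM ger0_norm//.
apply: (le_trans (ler_wpM2l Gamma_inv_ge0 h)).
by rewrite le_eqVlt; apply/orP; left; apply/eqP; ring.
Qed.

Lemma measurable_volt (f : R -> 'I_n -> R -> R) i :
  (forall l, measurable_fun setT (fun z : R * R => f z.1 l z.2)) ->
  measurable_fun setT (fun z : R * R => volt a A (f z.1) i z.2).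
Proof.
move=> mf; apply: measurable_funM => //.
apply: measurable_Rintegral_param.
have m12 : measurable_fun setT (fun z : (R * R) * R => z.1.2).
  by apply: measurableT_comp => //; exact: measurable_fst.
have mAs l : measurable_fun setT (fun z : (R * R) * R => A z.2 i l).
  exact: (measurableT_comp (mA i l)).
have mfs l : measurable_fun setT (fun z : (R * R) * R => f z.1.1 l z.2).
  apply: (measurableT_comp (mf l) (g := fun z : (R * R) * R => (z.1.1, z.2))).
  apply: measurable_fun_pair => //.
  by apply: measurableT_comp => //; exact: measurable_fst.
by meas.
Qed.

Lemma measurable_iter_volt (f : R -> 'I_n -> R -> R) m i :
  (forall l, measurable_fun setT (fun z : R * R => f z.1 l z.2)) ->
  measurable_fun setT (fun z : R * R => iter m (volt a A) (f z.1) i z.2).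
Proof.
move=> mf; elim: m i => [//|m ih] i /=.
exact: (@measurable_volt (fun r => iter m (volt a A) (f r))).
Qed.

Lemma measurable_iter_volt1 f m i : (forall l, measurable_fun setT (f l)) ->
  measurable_fun setT (iter m (volt a A) f i).
Proof.
move=> mf.
have h : measurable_fun setT
    (fun z : R * R => iter m (volt a A) ((fun=> f) z.1) i z.2).
  by apply: measurable_iter_volt => l; exact: (measurableT_comp (mf l)).
by have := measurableT_comp h (@pair1_measurable _ _ R R 0).
Qed.

Lemma iter_volt_bound k w f i c m t : weight a k w -> 0 <= k -> 0 <= c ->
  (forall l, measurable_fun setT (f l)) -> (forall l s, `|f l s| <= c * w s) ->
  `|iter m (volt a A) f i t| <= c * (n%:R * M * k / Gamma a) ^+ m * w t.
Proof.
move=> ww k0 c0 mf fw; elim: m i t => [|m ih] i t /=; first by rewrite expr0 mulr1.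
have q0 : 0 <= n%:R * M * k / Gamma a by rewrite !mulr_ge0// (M_ge0 i).
apply: le_trans (volt_bound _ _ ww _ _ ih) _.
- by rewrite mulr_ge0// exprn_ge0.
- by move=> l; exact: measurable_iter_volt1.
- by rewrite exprS le_eqVlt; apply/orP; left; apply/eqP; ring.
Qed.

Lemma volt_sum k w (m : nat) (F : 'I_m -> 'I_n -> R -> R) (x : 'I_m -> R) c i t :
  weight a k w -> 0 <= c ->
  (forall j l, measurable_fun setT (F j l)) ->
  (forall j l s, `|F j l s| <= c * w s) ->
  volt a A (fun l s => \sum_j F j l s * x j) i t = \sum_j volt a A (F j) i t * x j.
Proof.
move=> ww c0 mF Fw; rewrite /volt; have M0 := M_ge0 i.
under [RHS]eq_bigr do rewrite -mulrA.
rewrite -mulr_sumr; congr (_ * _).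
have c'0 : 0 <= n%:R * M * c by rewrite !mulr_ge0.
have Fi j : mu.-integrable setT
    (fun s => (tpow a (t - s) * \sum_l A s i l * F j l s)%:E).
  by apply: (weight_dominated _ ww c'0 _ (sum_dominated i (Fw j))).1; meas.
transitivity (\int[mu]_s \sum_j
    (x j * (tpow a (t - s) * \sum_l A s i l * F j l s))).
  apply: eq_Rintegral => s _.
  under eq_bigr do rewrite mulr_sumr.
  rewrite exchange_big/= mulr_sumr; apply: eq_bigr => j _.
  rewrite [RHS]mulrCA; congr (_ * _); rewrite mulr_sumr.
  by apply: eq_bigr => l _; ring.
rewrite /Rintegral.
under eq_integral do rewrite -sumEFin.
rewrite integral_sum//; last first.
  move=> j; under eq_fun do rewrite EFinM; exact: integrableZl.
under eq_bigr => j _.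
  under eq_integral do rewrite EFinM.
  rewrite integralZl// -(fineK (integrable_fin_num _ (Fi j)))// -EFinM mulrC.
  over.
by rewrite sumEFin.
Qed.

Lemma iter_volt_sum k w (m : nat) (F : 'I_m -> 'I_n -> R -> R) (x : 'I_m -> R)
    c r i t :
  weight a k w -> 0 <= k -> 0 <= c ->
  (forall j l, measurable_fun setT (F j l)) ->
  (forall j l s, `|F j l s| <= c * w s) ->
  iter r (volt a A) (fun l s => \sum_j F j l s * x j) i t =
  \sum_j iter r (volt a A) (F j) i t * x j.
Proof.
move=> ww k0 c0 mF Fw; elim: r i t => [//|r ih] i t /=.
have q0 : 0 <= n%:R * M * k / Gamma a by rewrite !mulr_ge0// (M_ge0 i).
rewrite -(@volt_sum k w _ (fun j => iter r (volt a A) (F j)) x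
   (c * (n%:R * M * k / Gamma a) ^+ r))//.
- by congr volt; apply/funext => l; apply/funext => s; exact: ih.
- by rewrite mulr_ge0// exprn_ge0.
- by move=> j l; exact: measurable_iter_volt1.
- by move=> j l s; exact: iter_volt_bound.
Qed.

Lemma volt_cvg k w (h : nat -> 'I_n -> R -> R) (g : 'I_n -> R -> R) c i t :
  weight a k w -> 0 <= c ->
  (forall N l, measurable_fun setT (h N l)) ->
  (forall N l s, `|h N l s| <= c * w s) ->
  (forall l s, h N l s @[N --> \oo] --> g l s) ->
  volt a A (h N) i t @[N --> \oo] --> volt a A g i t.
Proof.
move=> ww c0 mh hw hg; have M0 := M_ge0 i.
have c'0 : 0 <= n%:R * M * c by rewrite !mulr_ge0.
have mw := measurable_weight ww.
apply: cvgMl_tmp.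
apply: (Rintegral_dominated_cvg
  (G := fun s => tpow a (t - s) * (n%:R * M * c * w s))).
- by move=> N; meas.
- have [] := @weight_dominated k w (fun s => n%:R * M * c * w s) _ t ww c'0 _ _.
  + meas.
  + by move=> s; rewrite ger0_norm// mulr_ge0// (weight_ge0 ww).
  + by [].
- move=> N s; rewrite normrM (ger0_norm (tpow_ge0 _ _)).
  by rewrite ler_wpM2l ?tpow_ge0 ?sum_dominated.
- move=> s; apply: cvgMl_tmp.
  apply: cvg_big => [|l _]; first exact: add_continuous.
  by apply: cvgMl_tmp; exact: hg.
Qed.

(** Under [q_le] the operator has norm at most 1/2 in the norm defined by w, and
    the source f is finite in that norm. *)
Section series_volt.
Variables (k : R) (w : R -> R) (f : 'I_n -> R -> R) (c : R).
Hypotheses (ww : weight a k w) (k0 : 0 <= k) (c0 : 0 <= c).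
Hypothesis q_le : n%:R * M * k / Gamma a <= 2^-1.
Hypothesis mf : forall l, measurable_fun setT (f l).
Hypothesis fw : forall l s, `|f l s| <= c * w s.

Definition volt_sol (i : 'I_n) (t : R) : R :=
  limn (series (fun m => iter m (volt a A) f i t)).

Lemma iter_volt_half m i t :
  `|iter m (volt a A) f i t| <= c * w t * 2^-1 ^+ m.
Proof.
apply: le_trans (iter_volt_bound _ _ _ ww k0 c0 mf fw) _.
rewrite mulrAC ler_wpM2l//; first by rewrite mulr_ge0 ?(weight_ge0 ww).
by rewrite lerXn2r ?nnegrE// !mulr_ge0 ?(M_ge0 i).
Qed.

Lemma series_iter_volt_bound N i t :
  `|series (fun m => iter m (volt a A) f i t) N| <= 2 * c * w t.
Proof.
by rewrite -mulrA; apply: (cvg_series_half (fun m => iter_volt_half m i t)).2.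
Qed.

Lemma volt_sol_cvg i t :
  series (fun m => iter m (volt a A) f i t) N @[N --> \oo] --> volt_sol i t.
Proof. exact: (cvg_series_half (fun m => iter_volt_half m i t)).1. Qed.

Lemma volt_sol_bound i t : `|volt_sol i t| <= 2 * c * w t.
Proof.
have /cvg_norm h := @volt_sol_cvg i t.
rewrite -(cvg_lim (@Rhausdorff R) h); apply: limr_le; first by apply/cvg_ex; eexists; exact: h.
by apply: nearW => N; exact: series_iter_volt_bound.
Qed.

Let mS N l : measurable_fun setT
  (fun t => series (fun m => iter m (volt a A) f l t) N).
Proof. by apply: measurable_sum => m; exact: measurable_iter_volt1. Qed.

Lemma measurable_volt_sol i : measurable_fun setT (volt_sol i).
Proof.
apply: (measurable_fun_cvg (fun N => mS N i)) => t _; exact: volt_sol_cvg.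
Qed.

(** The partial sums satisfy S (N + 1) = f + V (S N).  They are dominated by a
    multiple of w, so V passes to the limit. *)
Lemma volt_solE i t : volt_sol i t = f i t + volt a A volt_sol i t.
Proof.
have c20 : 0 <= 2 * c by rewrite mulr_ge0.
have := @volt_cvg k w (fun N l s => series (fun m => iter m (volt a A) f l s) N)
  volt_sol (2 * c) i t ww c20 mS series_iter_volt_bound volt_sol_cvg.
move=> /(cvgD (cvg_cst (f i t))) h.
apply: (cvg_unique (@Rhausdorff R) _ h).
have := @volt_sol_cvg i t; rewrite -cvg_shiftS; apply: cvg_trans.
apply: near_eq_cvg; apply: nearW => N /=.
rewrite /series/= big_nat_recl//= big_mkord; congr (_ + _).
rewrite (_ : (fun _ _ => _) = (fun l s => \sum_(j < N)
   iter j (volt a A) f l s * (fun=> 1) j)); last first.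
  apply/funext => l; apply/funext => s; rewrite big_mkord.
  by apply: eq_bigr => j _; rewrite mulr1.
rewrite (@volt_sum k w _ (fun (j : 'I_N) => iter j (volt a A) f) _ c)//.
- by apply: eq_bigr => j _; rewrite mulr1.
- by move=> j l; exact: measurable_iter_volt1.
- move=> j l s; apply: le_trans (iter_volt_half j l s) _.
  rewrite ler_piMr// ?mulr_ge0 ?(weight_ge0 ww)// exprn_ile1//; lra.
Qed.
End series_volt.

(** The sources f r are integrated over the parameter r.  Their norms for the
    weights W r are at most U r, and [UWoo] makes the bounds integrable over
    r. *)
Section conv_volt.
Variables (k : R) (W : R -> R -> R) (U : R -> R) (f : R -> 'I_n -> R -> R).
Hypotheses (ww : forall r, weight a k (W r)) (k0 : 0 <= k).
Hypothesis mW : measurable_fun setT (fun z : R * R => W z.1 z.2).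
Hypotheses (U0 : forall r, 0 <= U r) (mU : measurable_fun setT U).
Hypothesis UWoo : forall t, (\int[mu]_r (U r * W r t)%:E < +oo)%E.
Hypothesis mf : forall l, measurable_fun setT (fun z : R * R => f z.1 l z.2).
Hypothesis fW : forall r l s, `|f r l s| <= U r * W r s.

Let q := n%:R * M * k / Gamma a.

Let W0 r s : 0 <= W r s. Proof. exact: (weight_ge0 (ww r)). Qed.

Let mf1 r l : measurable_fun setT (f r l).
Proof. by have := measurableT_comp (mf l) (@pair1_measurable _ _ R R r). Qed.

Let q0 (i : 'I_n) : 0 <= q.
Proof. by rewrite !mulr_ge0// (M_ge0 i). Qed.

Let QW m r i s : `|iter m (volt a A) (f r) i s| <= U r * q ^+ m * W r s.
Proof. by apply: iter_volt_bound. Qed.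

Let mQ m i : measurable_fun setT (fun z : R * R => iter m (volt a A) (f z.1) i z.2).
Proof. exact: measurable_iter_volt. Qed.

Let mQ1 m r i : measurable_fun setT (fun s => iter m (volt a A) (f r) i s).
Proof. exact: measurable_iter_volt1. Qed.

Let mQ2 m s i : measurable_fun setT (fun r => iter m (volt a A) (f r) i s).
Proof. by have := measurableT_comp (mQ m i) (@pair2_measurable _ _ R R s). Qed.

Let mW2 s : measurable_fun setT (fun r => W r s).
Proof. by have := measurableT_comp mW (@pair2_measurable _ _ R R s). Qed.

Let UW_integrable c s : mu.-integrable setT (fun r => (c * (U r * W r s))%:E).
Proof.
under eq_fun do rewrite EFinM; apply: integrableZl => //.
apply/integrableP; split; first by meas.
apply: le_lt_trans (UWoo s); rewrite le_eqVlt; apply/orP; left; apply/eqP.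
by apply: eq_integral => r _ /=; rewrite ger0_norm// mulr_ge0.
Qed.

Let Q_integrable m i s :
  mu.-integrable setT (EFin \o (fun r => iter m (volt a A) (f r) i s)).
Proof.
apply: le_integrable (UW_integrable (q ^+ m) s) => //.
  by apply/measurable_EFinP; exact: mQ2.
move=> r _ /=; rewrite lee_fin (le_trans (QW _ _ _ _))//.
by rewrite ger0_norm ?mulr_ge0 ?exprn_ge0 ?q0// le_eqVlt mulrAC mulrC eqxx.
Qed.

(** This is Fubini: [volt] integrates over s, the outer integral is over r.  The
    integral over s of the dominating function U r * C * W r s against the
    kernel is at most U r * C * k * W r t, because W r is a weight, and this is
    integrable over r. *)
Lemma conv_volt m i t :
  \int[mu]_r iter m.+1 (volt a A) (f r) i t =
  volt a A (fun l s => \int[mu]_r iter m (volt a A) (f r) l s) i t.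
Proof.
have M0 := M_ge0 i.
pose h s r := tpow a (t - s) * \sum_l A s i l * iter m (volt a A) (f r) l s.
have mAs l : measurable_fun setT (fun z : R * R => A z.1 i l).
  exact: (measurableT_comp (mA i l)).
have mQs l : measurable_fun setT
    (fun z : R * R => iter m (volt a A) (f z.2) l z.1).
  have := measurableT_comp (mQ m l) (@measurable_swap _ _ R R); exact.
have mh : measurable_fun setT (fun z : R * R => h z.1 z.2) by rewrite /h; meas.
pose C := n%:R * M * q ^+ m.
have C0 : 0 <= C by rewrite !mulr_ge0// exprn_ge0// q0.
have hS r s : `|\sum_l A s i l * iter m (volt a A) (f r) l s| <= U r * C * W r s.
  apply: le_trans (sum_dominated i (QW m r) s) _.
  by rewrite le_eqVlt; apply/orP; left; apply/eqP; rewrite /C; ring.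
move: C C0 hS => C C0 hS.
have h2 r : mu.-integrable setT (fun s => (h s r)%:E) /\
    `|\int[mu]_s h s r| <= U r * C * (k * W r t).
  apply: (weight_dominated _ (ww r)) => //; first by rewrite mulr_ge0.
  by have mQr := mQ1 m r; meas.
have mh2 : measurable_fun setT (fun r => \int[mu]_s h s r).
  apply: measurable_Rintegral_param.
  have := measurableT_comp mh (@measurable_swap _ _ R R); exact.
have ih2 : mu.-integrable setT (fun r => (\int[mu]_s h s r)%:E).
  apply: le_integrable (UW_integrable (C * k) t) => //; first exact/measurable_EFinP.
  move=> r _ /=; rewrite lee_fin (le_trans (h2 r).2)// ger0_norm ?mulr_ge0//.
  by rewrite le_eqVlt; apply/orP; left; apply/eqP; ring.
transitivity (\int[mu]_r ((Gamma a)^-1 * \int[mu]_s h s r)); first by [].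
rewrite RintegralZl//; congr (_ * _).
transitivity (\int[mu]_s \int[mu]_r h s r); last first.
  apply: eq_Rintegral => s _; by rewrite /h Rintegral_lincomb.
rewrite -(@RFubini R h) => //; last 3 first.
- move=> s.
  apply: le_integrable (UW_integrable (tpow a (t - s) * C) s) => //.
    apply/measurable_EFinP.
    by have := measurableT_comp mh (@pair1_measurable _ _ R R s).
  move=> r _ /=; rewrite lee_fin normrM (ger0_norm (tpow_ge0 _ _)).
  rewrite [leRHS]ger0_norm ?mulr_ge0 ?tpow_ge0// -mulrA ler_wpM2l ?tpow_ge0//.
  by apply: le_trans (hS r s) _; rewrite mulrAC mulrC.
- by move=> r; exact: (h2 r).1.
- apply: (@le_lt_trans _ _ (\int[mu]_r (C * k * (U r * W r t))%:E)%E).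
    apply: ge0_le_integral => //.
    + by move=> r _; apply: integral_ge0.
    + have -> : (fun r => \int[mu]_s `|h s r|%:E)%E = fubini_G mu
         (fun z : R * R => `|h z.1 z.2|%:E) by [].
      apply: measurable_fun_fubini_tonelli_G => //.
      by apply/measurable_EFinP; exact: measurableT_comp.
    + by meas.
    move=> r _.
    apply: (@le_trans _ _ (\int[mu]_s (U r * C * (tpow a (t - s) * W r s))%:E)%E).
      have mWr := measurable_weight (ww r).
      apply: ge0_le_integral => //.
      * apply/measurable_EFinP; apply: measurableT_comp => //.
        by apply/measurable_EFinP; exact: (measurable_int _ (h2 r).1).
      * by meas.
      * move=> s _; rewrite lee_fin normrM (ger0_norm (tpow_ge0 _ _)).
        by rewrite mulrCA ler_wpM2l ?tpow_ge0.
    under eq_integral do rewrite EFinM.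
    have mWr := measurable_weight (ww r).
    rewrite ge0_integralZl_EFin ?mulr_ge0//; last 2 first.
    * by move=> s _; rewrite lee_fin mulr_ge0 ?tpow_ge0.
    * by meas.
    rewrite (_ : C * k * _ = U r * C * (k * W r t)); last by ring.
    by rewrite [leRHS]EFinM lee_wpmul2l ?lee_fin ?mulr_ge0// (weight_le (ww r)).
  have := UW_integrable (C * k) t => /integrableP[_]; apply: le_lt_trans.
  rewrite le_eqVlt; apply/orP; left; apply/eqP; apply: eq_integral => r _ /=.
  by rewrite ger0_norm// !mulr_ge0.
Qed.

Lemma conv_iter_volt m i t :
  \int[mu]_r iter m (volt a A) (f r) i t =
  iter m (volt a A) (fun l s => \int[mu]_r f r l s) i t.
Proof.
elim: m i t => [//|m ih] i t; rewrite conv_volt iterS.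
by congr (volt a A _ i t); apply/funext => l; apply/funext => s; exact: ih.
Qed.

(** The Neumann series of an integrated source is the integral of the Neumann
    series: [conv_iter_volt] gives it term by term, and the geometric bounds
    dominate the partial sums. *)
Lemma conv_volt_sol i t : q <= 2^-1 ->
  series (fun m => iter m (volt a A) (fun l s => \int[mu]_r f r l s) i t) N
    @[N --> \oo] --> \int[mu]_r volt_sol (f r) i t.
Proof.
move=> q12.
have -> : (fun N => series (fun m =>
    iter m (volt a A) (fun l s => \int[mu]_r f r l s) i t) N) =
   (fun N => \int[mu]_r series (fun m => iter m (volt a A) (f r) i t) N).
  apply/funext => N; rewrite /series/= big_mkord.
  transitivity (\int[mu]_r (1 * \sum_(m < N) 1 * iter m (volt a A) (f r) i t)).
    rewrite Rintegral_lincomb ?mul1r; last by move=> m; exact: Q_integrable.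
    by apply: eq_bigr => m _; rewrite mul1r conv_iter_volt.
  apply: eq_Rintegral => r _; rewrite mul1r big_mkord.
  by apply: eq_bigr => m _; rewrite mul1r.
apply: (Rintegral_dominated_cvg (G := fun r => 2 * (U r * W r t))).
- by move=> N; apply: measurable_sum => m; exact: mQ2.
- exact: UW_integrable.
- move=> N r; rewrite mulrA.
  by apply: series_iter_volt_bound.
- by move=> r; apply: volt_sol_cvg.
Qed.
End conv_volt.
End volt.

(** * Fractional integrals on the whole line *)

(** The lower limit is implicit: f vanishes below it. *)
Definition rlint {R : realType} (b : R) (f : R -> R) (t : R) : R :=
  (Gamma b)^-1 * \int[lebesgue_measure]_s (tpow b (t - s) * f s).

Section EFin_integrable.
Context {R : realType}.
Notation mu := (@lebesgue_measure R).
Implicit Types f g : R -> R.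

Lemma integrableM_EFin x f : mu.-integrable setT (fun s => (f s)%:E) ->
  mu.-integrable setT (fun s => (x * f s)%:E).
Proof. by move=> h; exact: (integrableZl measurableT x h). Qed.

Lemma integrableD_EFin f g : mu.-integrable setT (fun s => (f s)%:E) ->
  mu.-integrable setT (fun s => (g s)%:E) ->
  mu.-integrable setT (fun s => (f s + g s)%:E).
Proof. by move=> h k; exact: (integrableD measurableT h k). Qed.

Lemma integrableB_EFin f g : mu.-integrable setT (fun s => (f s)%:E) ->
  mu.-integrable setT (fun s => (g s)%:E) ->
  mu.-integrable setT (fun s => (f s - g s)%:E).
Proof. by move=> h k; exact: (integrableB measurableT h k). Qed.
End EFin_integrable.

Section rlint.
Context {R : realType}.
Notation mu := (@lebesgue_measure R).
Variable a : R.
Hypotheses (a_gt0 : 0 < a) (a_le1 : a <= 1).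
Implicit Types b c d e r s t : R.

Let Gamma_inv_ge0 : 0 <= (Gamma a)^-1.
Proof. by rewrite invr_ge0 ltW// Gamma_gt0. Qed.

Lemma le_tpow b (v w : R) : 1 <= b -> v <= w -> tpow b v <= tpow b w.
Proof.
move=> b1 vw; have [v0|v0] := leP v 0; first by rewrite tpow_nonpos ?tpow_ge0.
rewrite !tpow_pos ?(lt_le_trans v0)// ge0_ler_powR ?nnegrE ?subr_ge0//;
  by rewrite ltW ?(lt_le_trans v0).
Qed.

Lemma ge_tpow b (v w : R) : b <= 1 -> 0 < v -> v <= w -> tpow b w <= tpow b v.
Proof.
move=> b1 v0 vw; rewrite !tpow_pos ?(lt_le_trans v0)//.
rewrite -opprB !powRN lef_pV2 ?posrE ?powR_gt0 ?(lt_le_trans v0)//.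
by rewrite ge0_ler_powR ?nnegrE ?subr_ge0//; apply: ltW => //; apply: lt_le_trans vw.
Qed.

Lemma tpow_conv_integrable b c t : 0 < b ->
  mu.-integrable setT (fun s => (tpow b (t - s) * tpow 1 (s - c))%:E) /\
  \int[mu]_s (tpow b (t - s) * tpow 1 (s - c)) = tpow (b + 1) (t - c) / b.
Proof.
move=> b0; split; last by rewrite /Rintegral integral_tpow_conv_tpow1.
apply/integrableP; split; first by meas.
apply: le_lt_trans (ltry (tpow (b + 1) (t - c) / b)).
rewrite -integral_tpow_conv_tpow1// le_eqVlt; apply/orP; left; apply/eqP.
by apply: eq_integral => s _ /=; rewrite ger0_norm// mulr_ge0 ?tpow_ge0.
Qed.

Lemma rlint_integrable (b c : R) (f : R -> R) (F t : R) : 0 < b -> measurable_fun setT f ->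
  (forall s, `|f s| <= F) -> (forall s, s <= c -> f s = 0) ->
  mu.-integrable setT (fun s => (tpow b (t - s) * f s)%:E).
Proof.
move=> b0 mf fF fc.
have F0 : 0 <= F by apply: le_trans (fF 0).
have h := (tpow_conv_integrable c t b0).1.
apply: (le_integrable measurableT _ _ (integrableZl measurableT F h)).
  by meas.
move=> s _ /=; rewrite lee_fin !normrM (ger0_norm (tpow_ge0 _ _)) (ger0_norm F0).
rewrite mulrCA ler_wpM2l ?tpow_ge0//.
have [sc|sc] := leP s c; first by rewrite fc// normr0 mulr_ge0.
by rewrite tpow1 subr_gt0 sc normr1 mulr1.
Qed.

(** For s < r the difference has a known sign, since the kernel decreases.  For
    s >= r only the kernel at t remains, and the last summand pays for it, its
    support ]2 r - t, t[ being large enough.  The point is that each term of the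
    bound has an explicit integral. *)
Lemma dist_tpow_le (b r t s : R) : b <= 1 -> r <= t ->
  `|tpow b (t - s) - tpow b (r - s)| <= tpow b (r - s) - tpow b (t - s) +
    2 * (tpow b (t - s) * tpow 1 (s - (2 * r - t))).
Proof.
move=> b1 rt; rewrite tpow1 subr_gt0; have [sr|rs] := ltP s r.
  have h : tpow b (t - s) <= tpow b (r - s).
    by apply: ge_tpow; rewrite ?subr_gt0// lerD2r.
  by rewrite distrC ger0_norm ?subr_ge0// lerDl mulr_ge0// mulr_ge0 ?tpow_ge0.
rewrite (@tpow_nonpos _ b (r - s)) ?subr_le0// subr0 ger0_norm ?tpow_ge0//.
have [st|ts] := ltP s t; last first.
  by rewrite (@tpow_nonpos _ b (t - s)) ?subr_le0// mul0r mulr0 subr0 add0r.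
rewrite (_ : (_ < s)%R = true); last by lra.
by rewrite mulr1 sub0r mulr_natl mulr2n addKr.
Qed.

(** In the integral of the bound [dist_tpow_le] over s > c, the first two terms
    contribute ((r - c)^a - (t - c)^a) / a <= 0, and only the last one is left.
    The result is a Hoelder estimate of exponent a. *)
Lemma rlint_holder (c : R) (f : R -> R) (F r t : R) : measurable_fun setT f ->
  (forall s, `|f s| <= F) -> (forall s, s <= c -> f s = 0) -> r <= t ->
  `|rlint a f t - rlint a f r| <=
  (Gamma a)^-1 * (F * (2 * (tpow (a + 1) (2 * (t - r)) / a))).
Proof.
move=> mf fF fc rt; have F0 : 0 <= F by apply: le_trans (fF 0).
have it := rlint_integrable t a_gt0 mf fF fc.
have ir := rlint_integrable r a_gt0 mf fF fc.
rewrite /rlint -mulrBr normrM ger0_norm// ler_wpM2l// -RintegralB//.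
have [i1 e1] := tpow_conv_integrable c r a_gt0.
have [i2 e2] := tpow_conv_integrable c t a_gt0.
have [i3 e3] := tpow_conv_integrable (2 * r - t) t a_gt0.
pose G s := tpow a (r - s) * tpow 1 (s - c) - tpow a (t - s) * tpow 1 (s - c) +
  2 * (tpow a (t - s) * tpow 1 (s - (2 * r - t))).
have iG : mu.-integrable setT (fun s => (G s)%:E).
  by apply: integrableD_EFin; [exact: integrableB_EFin|exact: integrableM_EFin].
have GE : \int[mu]_s (F * G s) <= F * (2 * (tpow (a + 1) (2 * (t - r)) / a)).
  rewrite RintegralZl// ler_wpM2l// /G RintegralD//; last 2 first.
  - exact: integrableB_EFin.
  - exact: integrableM_EFin.
  rewrite RintegralB// RintegralZl// e1 e2 e3.
  rewrite (_ : t - (2 * r - t) = 2 * (t - r)); last by ring.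
  rewrite gerDr subr_le0 ler_pM2r ?invr_gt0//.
  by apply: le_tpow; rewrite ?lerD2r// lerDr ltW.
apply: le_trans GE; apply: le_trans (le_normr_Rintegral _ _) _ => //.
  exact: integrableB_EFin.
apply: le_Rintegral => //.
- apply: integrable_norm => //.
  exact: integrableB_EFin.
- exact: integrableM_EFin.
move=> s _; rewrite -mulrBl normrM mulrC.
have [sc|cs] := leP s c.
  rewrite fc// normr0 mul0r mulr_ge0// /G.
  rewrite (@tpow_nonpos _ 1 (s - c)) ?subr_le0// !mulr0 subr0 add0r.
  by rewrite !mulr_ge0 ?tpow_ge0.
apply: ler_pM => //.
rewrite /G (tpow1 (s - c)) subr_gt0 cs !mulr1; exact: dist_tpow_le.
Qed.

Lemma tpow_small b e : 0 < b -> 0 < e ->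
  exists2 d : R, 0 < d & forall v, v <= d -> tpow (b + 1) v <= e.
Proof.
move=> b0 e0; exists (e `^ b^-1); first by rewrite powR_gt0.
move=> v vd; have [v0|v0] := leP v 0; first by rewrite tpow_nonpos// ltW.
rewrite tpow_pos// addrK.
rewrite -[leRHS](powRr1 (ltW e0)) -(mulVf (lt0r_neq0 b0)) powRrM.
by rewrite ge0_ler_powR ?nnegrE ?powR_ge0// ltW.
Qed.

Lemma continuous_rlint (c : R) (f : R -> R) (F : R) : measurable_fun setT f ->
  (forall s, `|f s| <= F) -> (forall s, s <= c -> f s = 0) ->
  continuous (rlint a f).
Proof.
move=> mf fF fc t; apply/cvgrPdist_le => /= e e0.
have F0 : 0 <= F by apply: le_trans (fF 0).
pose K := (Gamma a)^-1 * (F * (2 / a)).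
have K0 : 0 <= K by rewrite !mulr_ge0// invr_ge0 ltW.
have [d d0 hd] := tpow_small a_gt0 (divr_gt0 e0 (ltr_pwDr ltr01 K0)).
near=> r.
have key p q : p <= q -> 2 * (q - p) <= d -> `|rlint a f q - rlint a f p| <= e.
  move=> pq pqd; apply: le_trans (rlint_holder mf fF fc pq) _.
  rewrite (_ : _ * _ = K * tpow (a + 1) (2 * (q - p))); last by rewrite /K; ring.
  apply: (le_trans (ler_wpM2l K0 (hd _ pqd))).
  by rewrite mulrCA ler_piMr ?(ltW e0)// ler_pdivrMr ?mul1r ?lerDl// ltr_pwDr.
have rd : `|t - r| < d / 2.
  by near: r; exists (d / 2) => //=; rewrite divr_gt0.
have [tr|/ltW rt] := leP t r.
  by rewrite distrC key//; move: rd; rewrite distrC ger0_norm ?subr_ge0//; lra.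
by rewrite key//; move: rd; rewrite ger0_norm ?subr_ge0//; lra.
Unshelve. all: by end_near. Qed.
End rlint.

(** Fubini reduces the composition of two fractional integrals to the
    convolution of their kernels.  The convolution identity is a hypothesis
    because it is needed in two cases: exponents 1 - a and a, where it is the
    Beta integral, and exponents b and 1, where it is elementary. *)
Lemma rlint_rlint {R : realType} (b c d k t : R) (g : R -> R) : 0 <= k ->
  (forall r, (\int[lebesgue_measure]_s (tpow b (t - s) * tpow c (s - r))%:E =
              (k * tpow d (t - r))%:E)%E) ->
  measurable_fun setT g ->
  (forall s, lebesgue_measure.-integrable setT
    (fun r => (tpow c (s - r) * g r)%:E)) ->
  lebesgue_measure.-integrable setT (fun r => (tpow d (t - r) * g r)%:E) ->
  \int[lebesgue_measure]_s
    (tpow b (t - s) * \int[lebesgue_measure]_r (tpow c (s - r) * g r)) =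
  k * \int[lebesgue_measure]_r (tpow d (t - r) * g r).
Proof.
move=> k0 conv mg ic id.
pose h s r := tpow b (t - s) * (tpow c (s - r) * g r).
have hE s r : h s r = g r * (tpow b (t - s) * tpow c (s - r)).
  by rewrite /h mulrA mulrC.
have ib r : lebesgue_measure.-integrable setT
    (fun s => (tpow b (t - s) * tpow c (s - r))%:E).
  apply/integrableP; split; first by meas.
  apply: le_lt_trans (ltry (k * tpow d (t - r))); rewrite -conv.
  rewrite le_eqVlt; apply/orP; left; apply/eqP; apply: eq_integral => s _ /=.
  by rewrite ger0_norm// mulr_ge0 ?tpow_ge0.
transitivity (\int[lebesgue_measure]_s \int[lebesgue_measure]_r h s r).
  by apply: eq_Rintegral => s _; rewrite /h [RHS]RintegralZl//; exact: ic.
rewrite RFubini; last 4 first.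
- have mg2 : measurable_fun setT (fun z : R * R => g z.2).
    by apply: measurableT_comp => //; exact: measurable_snd.
  by rewrite /h; meas.
- by move=> s; exact: integrableM_EFin.
- by move=> r; under eq_fun do rewrite hE; exact: integrableM_EFin.
- have /integrableP[_ gi] := integrableM_EFin k id.
  apply: le_lt_trans gi; rewrite le_eqVlt; apply/orP; left; apply/eqP.
  apply: eq_integral => r _ /=.
  transitivity (\int[lebesgue_measure]_s
      (`|g r|%:E * (tpow b (t - s) * tpow c (s - r))%:E))%E.
    apply: eq_integral => s _; rewrite hE normrM -EFinM; congr EFin.
    by congr (_ * _); rewrite ger0_norm// mulr_ge0 ?tpow_ge0.
  rewrite ge0_integralZl_EFin//; last 2 first.
  + by move=> s _; rewrite lee_fin mulr_ge0 ?tpow_ge0.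
  + by meas.
  rewrite conv -EFinM; congr EFin.
  by rewrite !normrM (ger0_norm k0) (ger0_norm (tpow_ge0 _ _)); ring.
rewrite -[RHS]RintegralZl//.
apply: eq_Rintegral => r _; under eq_Rintegral do rewrite hE.
rewrite RintegralZl//; last exact: ib.
rewrite [X in _ * X](_ : _ = k * tpow d (t - r)); last first.
  by rewrite /Rintegral conv.
by rewrite mulrCA; congr (_ * _); rewrite mulrC.
Qed.

Lemma weight_expR {R : realType} (b l d : R) : 0 < b -> b <= 1 -> 0 < l -> 0 < d ->
  weight b (d `^ b / b + d `^ (b - 1) / l) (fun s => expR (l * s)).
Proof.
move=> b0 b1 l0 d0; split.
- by move=> s; exact: expR_ge0.
- by meas.
- by move=> t; exact: le_integral_tpow_expR_weight.
Qed.

Lemma weight_tpow {R : realType} (b l d r : R) : 0 < b -> b <= 1 -> 0 < l -> 0 < d ->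
  weight b (2 `^ (1 - b) * (2 * (d `^ b / b + d `^ (b - 1) / l)))
    (fun s => tpow b (s - r) * expR (l * (s - r))).
Proof.
move=> b0 b1 l0 d0; split.
- by move=> s; rewrite mulr_ge0 ?expR_ge0 ?tpow_ge0.
- by meas.
- by move=> t; exact: le_integral_tpow_tpow_weight.
Qed.

(** * The Volterra equation *)

Section volterra_equation.
Context {R : realType} {n : nat}.
Notation mu := (@lebesgue_measure R).
Variables (a t0 T M Ub : R) (A : R -> 'M[R]_n) (u : 'I_n -> R -> R).
Variable (x0 : 'I_n -> R).
Hypotheses (a_gt0 : 0 < a) (a_le1 : a <= 1).
Hypothesis mA : forall i j, measurable_fun setT (fun s => A s i j).
Hypothesis AM : forall s i j, `|A s i j| <= M.
Hypothesis A0 : forall s i j, ~~ (t0 <= s <= T) -> A s i j = 0.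
Hypothesis mu_ : forall i, measurable_fun setT (u i).
Hypothesis uU : forall i s, `|u i s| <= Ub.
Hypothesis u0 : forall i s, ~~ (t0 <= s <= T) -> u i s = 0.

Lemma volt_sol_sum k w (m : nat) (F : 'I_m -> 'I_n -> R -> R) (x : 'I_m -> R)
    c i t :
  weight a k w -> 0 <= k -> 0 <= c -> n%:R * M * k / Gamma a <= 2^-1 ->
  (forall j l, measurable_fun setT (F j l)) ->
  (forall j l s, `|F j l s| <= c * w s) ->
  volt_sol a A (fun l s => \sum_j F j l s * x j) i t =
  \sum_j volt_sol a A (F j) i t * x j.
Proof.
move=> ww k0 c0 q12 mF Fw; apply/cvg_lim => //.
have -> : series (fun r =>
     iter r (volt a A) (fun l s => \sum_j F j l s * x j) i t) =
   (fun N => \sum_j series (fun r => iter r (volt a A) (F j) i t) N * x j).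
  apply/funext => N; rewrite /series/=.
  under eq_bigr do rewrite (iter_volt_sum a_gt0 a_le1 mA AM _ _ _ _ ww k0 c0 mF Fw).
  by rewrite exchange_big/=; apply: eq_bigr => j _; rewrite mulr_suml.
apply: cvg_big => [|j _]; first exact: add_continuous.
apply: cvgMr_tmp.
exact: (volt_sol_cvg a_gt0 a_le1 mA AM ww k0 c0 q12 (mF j) (Fw j)).
Qed.

(** The two constants of [weight_expR] and [weight_tpow] are e and P e, with the
    same e; as P >= 1, it is enough to make P e small. *)
Lemma exists_weights : exists l k1 k2 : R, [/\ 0 < l, 0 <= k1, 0 <= k2 &
  [/\ weight a k1 (fun s => expR (l * s)),
      forall r, weight a k2 (fun s => tpow a (s - r) * expR (l * (s - r))),
      n%:R * M * k1 / Gamma a <= 2^-1 & n%:R * M * k2 / Gamma a <= 2^-1 ]].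
Proof.
have G0 : 0 < Gamma a by exact: Gamma_gt0.
pose N := n%:R * `|M| + 1.
have N0 : 0 < N by rewrite ltr_pwDr// mulr_ge0.
pose P := 2 `^ (1 - a) * 2.
have P1 : 1 <= P.
  rewrite /P (@le_trans _ _ (1 * 2))//; first by lra.
  rewrite ler_wpM2r// -[leLHS](powRr0 2) ler_powR ?subr_ge0//; lra.
have P0 : 0 < P by exact: lt_le_trans P1.
have H : 0 < Gamma a / (2 * P * N) by rewrite divr_gt0// !mulr_gt0.
have [l [d [l0 d0 e_le]]] := exists_small_weight a_gt0 H.
set e := (_ + _) in e_le.
have e0 : 0 <= e.
  by rewrite addr_ge0// divr_ge0 ?powR_ge0// ltW.
exists l, e, (2 `^ (1 - a) * (2 * e)); split => //.
  by rewrite !mulr_ge0 ?powR_ge0.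
have small (k : R) : 0 <= k -> k <= P * e -> n%:R * M * k / Gamma a <= 2^-1.
  move=> k0 kPe; rewrite ler_pdivrMr//.
  apply: (@le_trans _ _ (N * (P * (Gamma a / (2 * P * N))))).
    apply: (@le_trans _ _ (N * k)).
      rewrite ler_wpM2r// /N (@le_trans _ _ (n%:R * `|M|)) ?lerDl//.
      by rewrite ler_wpM2l// ler_norm.
    apply: ler_wpM2l; first exact: ltW.
    by apply: (le_trans kPe); apply: ler_wpM2l => //; exact: ltW.
  rewrite le_eqVlt; apply/orP; left; apply/eqP; field.
  by rewrite !gt_eqF.
split.
- exact: weight_expR.
- by move=> r; exact: weight_tpow.
- by apply: small => //; rewrite ler_peMl.
- by apply: small; rewrite ?mulrA// !mulr_ge0// powR_ge0.
Qed.

(** Column j of the identity matrix, extended by 0 to t < t0. *)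
Definition Phi_init (j i : 'I_n) (t : R) : R := \1_(`[t0, +oo[) t * (i == j)%:R.

(** Column j of the term of index 0 of the series Phi(t, r). *)
Definition RLPhi_init (j : 'I_n) (r : R) (i : 'I_n) (t : R) : R :=
  (i == j)%:R * (tpow a (t - r) / Gamma a).

(** Entry i of Phi~ x0 plus the integral of Phi u, with the columns of Phi~ and
    Phi in the form of Neumann series. *)
Definition neumann_sol (i : 'I_n) (t : R) : R :=
  \sum_j volt_sol a A (Phi_init j) i t * x0 j +
  \int[mu]_r \sum_j volt_sol a A (RLPhi_init j r) i t * u j r.

Definition neumann_rhs (i : 'I_n) (t : R) : R :=
  \sum_l A t i l * neumann_sol l t + u i t.

Let indic_expR l t : 0 < l -> \1_(`[t0, +oo[) t <= expR (l * (t - t0)).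
Proof.
move=> l0; rewrite indicE; case: (boolP (_ \in _)) => [|_]; last exact: expR_ge0.
rewrite inE/= in_itv/= andbT => t0t.
by rewrite -expR0 ler_expR mulr_ge0 ?subr_ge0// ltW.
Qed.

Let supp r : \1_(`[t0, T]) r = (t0 <= r <= T)%R%:R :> R.
Proof. by rewrite indicE mem_setE in_itv. Qed.

(** The two parts of [neumann_sol] are the Neumann series with sources x0 and
    J^a u, by linearity and by [conv_volt_sol] respectively.  They satisfy
    y1 = x0 + V y1 and y2 = J^a u + V y2, where V f = J^a (A f); adding gives the
    third claim. *)
Lemma neumann_solP :
  [/\ forall i, measurable_fun setT (neumann_rhs i),
      exists F, forall i s, `|neumann_rhs i s| <= F,
      forall i t, neumann_sol i t =
        \1_(`[t0, +oo[) t * x0 i + rlint a (neumann_rhs i) t,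
      forall j i t, cvgn (series (fun m => iter m (volt a A) (Phi_init j) i t)) &
      forall j r i t,
        cvgn (series (fun m => iter m (volt a A) (RLPhi_init j r) i t)) ].
Proof.
have [l [k1 [k2 [l0 k10 k20 [w1 w2 q1 q2]]]]] := exists_weights.
have Gi0 : 0 <= (Gamma a)^-1 by rewrite invr_ge0 ltW// Gamma_gt0.
pose E0 := expR (- (l * t0)).
have E00 : 0 <= E0 by exact: expR_ge0.
have mP j i : measurable_fun setT (Phi_init j i).
  by rewrite /Phi_init; apply: measurable_funM => //; exact: measurable_indic.
have Pw j i s : `|Phi_init j i s| <= E0 * expR (l * s).
  rewrite /Phi_init ger0_norm ?mulr_ge0 ?ler0n// -expRD.
  rewrite (_ : - (l * t0) + l * s = l * (s - t0)); last by ring.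
  by apply: le_trans (indic_expR s l0); rewrite ler_piMr ?lern1 ?leq_b1.
have mQ j r i : measurable_fun setT (RLPhi_init j r i).
  by rewrite /RLPhi_init; meas.
have Qw j r i s : `|RLPhi_init j r i s| <=
    (Gamma a)^-1 * (tpow a (s - r) * expR (l * (s - r))).
  rewrite /RLPhi_init ger0_norm ?mulr_ge0 ?divr_ge0 ?tpow_ge0 ?invr_ge0//; last first.
    by rewrite -invr_ge0.
  have [sr|rs] := leP s r.
    by rewrite (@tpow_nonpos _ a) ?subr_le0// !(mul0r,mulr0).
  apply: (@le_trans _ _ (tpow a (s - r) / Gamma a)).
    by rewrite ler_piMl ?lern1 ?leq_b1// mulr_ge0 ?tpow_ge0.
  rewrite mulrC ler_wpM2l// ler_peMr ?tpow_ge0// -expR0 ler_expR.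
  by rewrite mulr_ge0 ?subr_ge0// ltW.
(* f1 is x0, extended by 0 to t < t0: the combination with coefficients x0 of
   the columns of Phi~ is the Neumann series with source f1. *)
pose f1 i t := \sum_j Phi_init j i t * x0 j.
have f1E i t : f1 i t = \1_(`[t0, +oo[) t * x0 i.
  rewrite /f1 (bigD1 i)//= big1 ?addr0 /Phi_init ?eqxx ?mulr1// => j ji.
  by rewrite eq_sym (negbTE ji) mulr0 mul0r.
have mf1 i : measurable_fun setT (f1 i).
  by apply: measurable_sum => j; apply: measurable_funM.
pose X := \sum_j `|x0 j|.
have X0 : 0 <= X by apply: sumr_ge0.
have Xx i : `|x0 i| <= X by rewrite /X (bigD1 i)//= lerDl sumr_ge0.
have f1w i s : `|f1 i s| <= (E0 * X) * expR (l * s).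
  rewrite f1E normrM mulrAC ler_pM//.
  rewrite ger0_norm ?indicE ?ler0n// -indicE -expRD.
  rewrite (_ : - (l * t0) + l * s = l * (s - t0)); last by ring.
  exact: indic_expR.
have y1E i t : \sum_j volt_sol a A (Phi_init j) i t * x0 j = volt_sol a A f1 i t.
  by rewrite /f1 (volt_sol_sum _ _ _ w1 k10 E00 q1 mP Pw).
(* f2 r is the source of Phi(., r) u(r); its integral over r is f3 = J^a u.  The
   factor U carries the support [t0, T] of u in r, without which the weights
   W r would not be integrable over r. *)
pose f2 r i s := \sum_j RLPhi_init j r i s * u j r.
have f2E r i s : f2 r i s = (Gamma a)^-1 * (tpow a (s - r) * u i r).
  rewrite /f2 (bigD1 i)//= big1 ?addr0 /RLPhi_init ?eqxx ?mul1r.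
    by rewrite mulrAC mulrC.
  by move=> j ji; rewrite eq_sym (negbTE ji) !mul0r.
pose U r := (Gamma a)^-1 * Ub * \1_(`[t0, T]) r.
pose W r s := tpow a (s - r) * expR (l * (s - r)).
have Ub0 (i : 'I_n) : 0 <= Ub by exact: le_trans (uU i 0).
have us i s : `|u i s| <= Ub * \1_(`[t0, T]) s.
  rewrite supp; case: (boolP (t0 <= s <= T)) => st; first by rewrite mulr1.
  by rewrite u0// normr0 mulr0.
have y2cvg i t :
  series (fun m => iter m (volt a A) (fun l s => \int[mu]_r f2 r l s) i t) N
    @[N --> \oo] --> \int[mu]_r volt_sol a A (f2 r) i t.
  apply: (@conv_volt_sol _ _ a M A a_gt0 a_le1 mA AM k2 W U) => //.
  - by rewrite /W; meas.
  - by move=> r; rewrite !mulr_ge0 ?(Ub0 i)// supp.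
  - by rewrite /U; apply: measurable_funM => //; exact: measurable_indic.
  - move=> {}t.
    pose C := (Gamma a)^-1 * Ub * (expR (l * t) * expR (- (2 * (l * t0)))).
    have C0 : 0 <= C by rewrite !mulr_ge0 ?expR_ge0 ?(Ub0 i).
    apply: (@le_lt_trans _ _ (\int[mu]_r (C%:E * (tpow a (t - r) * expR (l * r))%:E))%E).
      apply: ge0_le_integral => //.
      + by move=> r _; rewrite lee_fin !mulr_ge0 ?tpow_ge0 ?expR_ge0 ?(Ub0 i)// supp.
      + rewrite /U /W; apply/measurable_EFinP.
        by apply: measurable_funM; [apply: measurable_funM => //; exact: measurable_indic|meas].
      + by apply: measurable_funeM; meas.
      move=> r _; rewrite -EFinM lee_fin /U /W /C supp.
      case: (boolP (t0 <= r <= T)) => [/andP[t0r _]|_]; last first.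
        by rewrite mulr0 mul0r !mulr_ge0 ?tpow_ge0 ?expR_ge0 ?(Ub0 i).
      rewrite mulr1 -[leRHS]mulrA ler_wpM2l ?mulr_ge0 ?(Ub0 i)//.
      rewrite [leRHS]mulrCA ler_wpM2l ?tpow_ge0// -!expRD ler_expR.
      rewrite -subr_ge0 [X in 0 <= X](_ : _ = 2 * (l * (r - t0))); last by ring.
      by rewrite !mulr_ge0 ?subr_ge0// ltW.
    rewrite ge0_integralZl_EFin//; last 2 first.
    + by move=> r _; rewrite lee_fin mulr_ge0 ?tpow_ge0 ?expR_ge0.
    + by meas.
    rewrite lte_mul_pinfty//.
    exact: le_lt_trans (weight_le w1 t) (ltry _).
  - move=> j; rewrite (_ : (fun _ => _) = (fun z : R * R =>
      (Gamma a)^-1 * (tpow a (z.2 - z.1) * u j z.1))); last first.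
      by apply/funext => z; rewrite f2E.
    have muj : measurable_fun setT (fun z : R * R => u j z.1).
      by apply: measurableT_comp => //; exact: measurable_fst.
    by meas.
  - move=> r j s; rewrite f2E !normrM (ger0_norm Gi0) (ger0_norm (tpow_ge0 _ _)).
    rewrite /U /W -!mulrA ler_wpM2l//.
    have [sr|rs] := leP s r.
      by rewrite (@tpow_nonpos _ a) ?subr_le0// !(mul0r,mulr0).
    apply: (le_trans (ler_wpM2l (tpow_ge0 _ _) (us j r))).
    rewrite [leRHS]mulrA [leRHS]mulrCA ler_wpM2l ?tpow_ge0//.
    rewrite ler_peMr ?mulr_ge0 ?(Ub0 i)// ?supp//.
    by rewrite -expR0 ler_expR mulr_ge0 ?subr_ge0// ltW.
have y2E i t : \int[mu]_r \sum_j volt_sol a A (RLPhi_init j r) i t * u j r =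
    \int[mu]_r volt_sol a A (f2 r) i t.
  apply: eq_Rintegral => r _.
  by rewrite (volt_sol_sum (u^~ r) _ _ (w2 r) k20 Gi0 q2 (mQ^~ r) (fun j => Qw j r)).
pose f3 i t := rlint a (u i) t.
have uc i (s : R) : s <= t0 - 1 -> u i s = 0.
  move=> st0; rewrite u0//; apply/negP => /andP[t0s _].
  by have := le_trans t0s st0; rewrite lerBrDr gerDl ler10.
have iu i t : mu.-integrable setT (fun s => (tpow a (t - s) * u i s)%:E).
  exact: (rlint_integrable t a_gt0 (mu_ i) (uU i) (@uc i)).
have f3E i t : \int[mu]_r f2 r i t = f3 i t.
  under eq_Rintegral do rewrite f2E.
  by rewrite RintegralZl//; exact: iu.
have y2V i t : \int[mu]_r volt_sol a A (f2 r) i t = volt_sol a A f3 i t.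
  apply/esym/cvg_lim => //.
  rewrite (_ : f3 = (fun l s => \int[mu]_r f2 r l s)); first exact: y2cvg.
  by apply/funext => j; apply/funext => s; rewrite f3E.
have mf3 i : measurable_fun setT (f3 i).
  apply: measurable_funM => //; apply: measurable_Rintegral_param.
  have mui : measurable_fun setT (fun z : R * R => u i z.2).
    by apply: measurableT_comp => //; exact: measurable_snd.
  by meas.
have uw i s : `|u i s| <= Ub * E0 * expR (l * s).
  apply: (le_trans (us i s)); rewrite -mulrA ler_wpM2l ?(Ub0 i)//.
  rewrite supp -expRD (_ : - (l * t0) + l * s = l * (s - t0)); last by ring.
  case: (boolP (t0 <= s <= T)) => [/andP[t0s _]|_]; last exact: expR_ge0.
  by rewrite -expR0 ler_expR mulr_ge0 ?subr_ge0// ltW.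
pose c3 := (Gamma a)^-1 * (Ub * E0 * k1).
have c30 (i : 'I_n) : 0 <= c3 by rewrite !mulr_ge0 ?(Ub0 i).
have f3w i s : `|f3 i s| <= c3 * expR (l * s).
  rewrite /f3 /rlint normrM (ger0_norm Gi0) /c3 -(mulrA (Gamma a)^-1) ler_wpM2l//.
  rewrite -(mulrA (Ub * E0)).
  by apply: (weight_dominated s w1 _ (mu_ i) (uw i)).2; rewrite mulr_ge0 ?(Ub0 i).
clearbody c3; pose y1 := volt_sol a A f1; pose y2 := volt_sol a A f3.
have yE i t : neumann_sol i t = y1 i t + y2 i t.
  by rewrite /neumann_sol y1E y2E y2V.
have c10 : 0 <= E0 * X by rewrite mulr_ge0.
have my1 i : measurable_fun setT (y1 i).
  exact: (measurable_volt_sol a_gt0 a_le1 mA AM w1 k10 c10 q1 mf1 f1w).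
have my2 i : measurable_fun setT (y2 i).
  exact: (measurable_volt_sol a_gt0 a_le1 mA AM w1 k10 (c30 i) q1 mf3 f3w).
have y1w i s : `|y1 i s| <= 2 * (E0 * X) * expR (l * s).
  exact: (volt_sol_bound a_gt0 a_le1 mA AM w1 k10 c10 q1 mf1 f1w).
have y2w i s : `|y2 i s| <= 2 * c3 * expR (l * s).
  exact: (volt_sol_bound a_gt0 a_le1 mA AM w1 k10 (c30 i) q1 mf3 f3w).
have M0 (i : 'I_n) : 0 <= M by exact: le_trans (AM 0 i i).
have my i : measurable_fun setT (neumann_sol i).
  by rewrite (funext (yE i)); apply: measurable_funD.
have mrhs i : measurable_fun setT (neumann_rhs i).
  by rewrite /neumann_rhs; meas.
have mS (y : 'I_n -> R -> R) i : (forall j, measurable_fun setT (y j)) ->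
    measurable_fun setT (fun s => \sum_j A s i j * y j s).
  by move=> mj; apply: measurable_sum => j; exact: measurable_funM.
split => //.
- pose C := 2 * (E0 * X) + 2 * c3.
  exists (n%:R * M * C * expR (l * T) + Ub) => i s.
  have C0 : 0 <= C by rewrite addr_ge0// mulr_ge0// ?(c30 i).
  apply: (le_trans (ler_normD _ _)); apply: lerD; last exact: uU.
  have yw j r : `|neumann_sol j r| <= C * expR (l * r).
    by rewrite yE mulrDl (le_trans (ler_normD _ _))// lerD.
  case: (boolP (t0 <= s <= T)) => st.
    apply: (le_trans (sum_dominated AM i yw s)).
    rewrite ler_wpM2l ?mulr_ge0 ?(M0 i)// ler_expR ler_wpM2l//; first exact: ltW.
    by case/andP: st.
  rewrite big1 ?normr0 ?mulr_ge0 ?expR_ge0 ?(M0 i)// => j _.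
  by rewrite A0// mul0r.
- move=> i t; rewrite yE /y1 /y2.
  rewrite (volt_solE a_gt0 a_le1 mA AM w1 k10 c10 q1 mf1 f1w).
  rewrite (volt_solE a_gt0 a_le1 mA AM w1 k10 (c30 i) q1 mf3 f3w).
  rewrite -/y1 -/y2 f1E -addrA; congr (_ + _).
  have i1 : mu.-integrable setT
      (fun s => (tpow a (t - s) * \sum_j A s i j * y1 j s)%:E).
    apply: (weight_dominated t w1 _ (mS _ i my1) (sum_dominated AM i y1w)).1.
    by rewrite !mulr_ge0 ?(M0 i).
  have i2 : mu.-integrable setT
      (fun s => (tpow a (t - s) * \sum_j A s i j * y2 j s)%:E).
    apply: (weight_dominated t w1 _ (mS _ i my2) (sum_dominated AM i y2w)).1.
    by rewrite !mulr_ge0 ?(M0 i) ?(c30 i).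
  transitivity ((Gamma a)^-1 * \int[mu]_s (
      tpow a (t - s) * (\sum_j A s i j * y1 j s) +
      tpow a (t - s) * (\sum_j A s i j * y2 j s) + tpow a (t - s) * u i s)).
    rewrite RintegralD//; last 2 first.
    + exact: integrableD_EFin.
    + exact: iu.
    by rewrite RintegralD// /volt /f3 /rlint; ring.
  rewrite /rlint; congr (_ * _); apply: eq_Rintegral => s _.
  rewrite -!mulrDr; congr (_ * (_ + _)); rewrite -big_split/=.
  by apply: eq_bigr => j _; rewrite -mulrDr yE.
- move=> j i t; apply/cvg_ex; exists (volt_sol a A (Phi_init j) i t).
  exact: (volt_sol_cvg a_gt0 a_le1 mA AM w1 k10 E00 q1 (mP j) (Pw j)).
- move=> j r i t; apply/cvg_ex; exists (volt_sol a A (RLPhi_init j r) i t).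
  exact: (volt_sol_cvg a_gt0 a_le1 mA AM (w2 r) k20 Gi0 q2 (mQ j r) (Qw j r)).
Qed.
End volterra_equation.

Lemma cvg_mx_entries {R : realType} (T : Type) (F : set_system T) {FF : Filter F}
    m p (f : T -> 'M[R]_(m, p)) (l : 'M[R]_(m, p)) :
  (forall i j, f s i j @[s --> F] --> l i j) -> f s @[s --> F] --> l.
Proof.
move=> fl B [P lP PB]; apply: filterS PB _.
suff H : \forall s \near F, forall i j, P i j (f s i j) by exact: H.
by apply: filter_forall => i; apply: filter_forall => j; exact: (fl i j _ (lP i j)).
Qed.

Lemma cvg_mx_entry {R : realType} (T : Type) (F : set_system T) {FF : Filter F}
    m p (f : T -> 'M[R]_(m, p)) (l : 'M[R]_(m, p)) i j :
  f s @[s --> F] --> l -> f s i j @[s --> F] --> l i j.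
Proof. by move=> fl; exact: (cvg_comp _ _ fl (@coord_continuous R m p i j l)). Qed.

(** * Iterated integrals as Neumann series *)

(** At r = t both integrands vanish, [RL_integrand] because 0 to the power
    b - 1 is 0 when b != 1. *)
Lemma RL_int_rlint {R : realType} (b s t : R) (f g : R -> R) : b != 1 ->
  (forall r, s <= r -> r < t -> f r = g r) -> (forall r, r < s -> g r = 0) ->
  RL_int b s f t = rlint b g t.
Proof.
move=> b1 fg g0; congr (_ * _); rewrite Rintegral_mkcond.
apply: eq_Rintegral => r _; rewrite patchE mem_setE in_itv/= /RL_integrand.
have [rt|tr] := ltP r t; last first.
  rewrite tpow_nonpos ?subr_le0// mul0r; case: ifP => // /andP[_ rt].
  have -> : r = t by apply/le_anti; rewrite tr rt.
  by rewrite subrr powR0 ?mul0r// subr_eq0.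
rewrite (ltW rt) andbT; case: ifPn => sr.
  by rewrite tpow_pos ?subr_gt0// fg.
by rewrite g0 ?mulr0// ltNge.
Qed.

Section clipped.
Context {R : realType} {n : nat}.
Notation mu := (@lebesgue_measure R).
Variables (a t0 T : R) (A : R -> 'M[R]_n).
Hypotheses (a_gt0 : 0 < a) (a_lt1 : a < 1).

(** Cutting the data off outside [t0, T] makes them bounded and measurable on the
    line.  By causality, values at times in [t0, T] are not affected. *)
Definition clip (m p : nat) (F : R -> 'M[R]_(m, p)) (s : R) : 'M[R]_(m, p) :=
  if t0 <= s <= T then F s else 0.

(** The kernel only sees the past, so a source that vanishes before s produces
    nothing before s. *)
Lemma iter_volt_causal (f : 'I_n -> R -> R) s k i t :
  (forall l r, r < s -> f l r = 0) -> t < s ->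
  iter k (volt a (clip A)) f i t = 0.
Proof.
move=> f0; elim: k i t => [|k ih] i t ts; first exact: f0.
rewrite iterS /volt (@Rintegral_tpow_causal _ a s) ?mulr0 ?(ltW ts)// => r rs.
by rewrite big1// => l _; rewrite ih ?mulr0.
Qed.

(** The value at t of an iterated integral with lower limit s depends on the data
    in [s, t] only, and there [clip A] is A. *)
Lemma PB_iter_volt (F0 : R -> 'M[R]_n) (f : 'I_n -> R -> R) s j k i t :
  t0 <= s ->
  (forall l r, s <= r -> r <= T -> F0 r l j = f l r) ->
  (forall l r, r < s -> f l r = 0) ->
  s <= t -> t <= T ->
  PB_iter a s A F0 k t i j = iter k (volt a (clip A)) f i t.
Proof.
move=> t0s Ff f0; elim: k i t => [|k ih] i t st tT; first exact: Ff.
rewrite /= /mxRL_int mxE; apply: RL_int_rlint; first by rewrite lt_eqF.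
- move=> r sr rt; rewrite mxE; apply: eq_bigr => l _; rewrite ih//.
    by rewrite /clip (le_trans t0s sr) (le_trans (ltW rt) tT).
  exact: le_trans (ltW rt) tT.
- move=> r rs; rewrite big1// => l _.
  by rewrite (iter_volt_causal _ _ f0)// mulr0.
Qed.

Lemma limn_series_mx (u : nat -> 'M[R]_n) i j :
  (forall i j, cvgn (series (fun k => u k i j))) ->
  limn (series u) i j = limn (series (fun k => u k i j)).
Proof.
move=> cu.
pose L := \matrix_(i, j) limn (series (fun k => u k i j)).
suff h : series u N @[N --> \oo] --> L.
  by rewrite (cvg_lim _ h) ?mxE//; exact: norm_hausdorff.
apply: cvg_mx_entries => i' j'; rewrite mxE.
rewrite (_ : (fun N => _) = series (fun k => u k i' j')); first exact: cu.
by apply/funext => N; rewrite /series/= summxE.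
Qed.

Lemma caputo_Phi_volt i j t : t0 <= t -> t <= T ->
  (forall i j, cvgn (series (fun m => iter m (volt a (clip A)) (Phi_init t0 j) i t))) ->
  caputo_Phi a A t t0 i j = volt_sol a (clip A) (Phi_init t0 j) i t.
Proof.
move=> t0t tT cv.
have E k i' j' : caputo_term a t0 A k t i' j' =
    iter k (volt a (clip A)) (Phi_init t0 j') i' t.
  apply: PB_iter_volt => //.
  - move=> l r t0r rT; rewrite mxE /Phi_init indicE mem_setE in_itv/= t0r.
    by rewrite mul1r.
  - move=> l r rt0; rewrite /Phi_init indicE mem_setE in_itv/= leNgt rt0.
    by rewrite mul0r.
rewrite /caputo_Phi limn_series_mx.
  by congr (limn (series _)); apply/funext => k; rewrite E.
by move=> i' j'; under eq_fun do rewrite E; exact: cv.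
Qed.

Lemma RL_Phi_volt i j s t : t0 <= s -> s <= t -> t <= T ->
  (forall i j, cvgn (series (fun m => iter m (volt a (clip A)) (RLPhi_init a j s) i t))) ->
  RL_Phi a A t s i j = volt_sol a (clip A) (RLPhi_init a j s) i t.
Proof.
move=> t0s st tT cv.
have E k i' j' : RL_term a s A k t i' j' =
    iter k (volt a (clip A)) (RLPhi_init a j' s) i' t.
  apply: PB_iter_volt => //.
  - move=> l r sr rT; rewrite mxE -[LHS]mulr_natl /RLPhi_init; congr (_ * (_ / _)).
    move: sr; rewrite le_eqVlt => /predU1P[<-|sr]; last by rewrite tpow_pos ?subr_gt0.
    by rewrite subrr tpow_nonpos// powR0// subr_eq0 lt_eqF.
  - move=> l r rs; rewrite /RLPhi_init tpow_nonpos ?subr_le0 ?(ltW rs)//.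
    by rewrite mul0r mulr0.
rewrite /RL_Phi limn_series_mx.
  by congr (limn (series _)); apply/funext => k; rewrite E.
by move=> i' j'; under eq_fun do rewrite E; exact: cv.
Qed.

Lemma volt_sol_causal (f : 'I_n -> R -> R) s i t :
  (forall l r, r < s -> f l r = 0) -> t < s ->
  volt_sol a (clip A) f i t = 0.
Proof.
move=> f0 ts; rewrite /volt_sol (_ : series _ = fun=> 0) ?lim_cst//.
apply/funext => N; rewrite /series/= big1// => k _.
exact: iter_volt_causal ts.
Qed.

Variables (u : R -> 'cV[R]_n) (x0 : 'cV[R]_n).

Definition PB_sol (t : R) : 'cV[R]_n := caputo_Phi a A t t0 *m x0 +
  \col_i \int[mu]_(tau in `[t0, t]) (RL_Phi a A t tau *m u tau) i 0.

Lemma PB_sol_neumann i t : t0 <= t -> t <= T ->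
  (forall j i t, cvgn (series (fun m => iter m (volt a (clip A)) (Phi_init t0 j) i t))) ->
  (forall j r i t, cvgn (series (fun m => iter m (volt a (clip A)) (RLPhi_init a j r) i t))) ->
  PB_sol t i 0 = neumann_sol a t0 (clip A) (fun l s => clip u s l 0)
    (fun l => x0 l 0) i t.
Proof.
move=> t0t tT c1 c2; rewrite !mxE; congr (_ + _).
  by apply: eq_bigr => j _; rewrite caputo_Phi_volt// => i' j'; exact: c1.
rewrite Rintegral_mkcond; apply: eq_Rintegral => r _.
rewrite patchE mem_setE in_itv/=; case: ifPn => [/andP[t0r rt]|rN].
  rewrite mxE; apply: eq_bigr => j _.
  rewrite RL_Phi_volt//.
  by rewrite /clip t0r (le_trans rt tT).
rewrite big1// => j _; rewrite /clip; case: ifPn => [/andP[t0r rT]|_]; last first.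
  by rewrite mxE mulr0.
rewrite (@volt_sol_causal _ r) ?mul0r//.
  move=> l s sr; rewrite /RLPhi_init tpow_nonpos ?subr_le0 ?(ltW sr)//.
  by rewrite mul0r mulr0.
by move: rN; rewrite t0r/= -ltNge.
Qed.
End clipped.

(** * Restriction to compact intervals *)

(** If I contains a point beyond t, it serves as T; otherwise t is the right end
    point of I, and T = t.  Either way, a compact interval that ends at T
    sees all of I near t. *)
Lemma interval_local_top {R : realType} (I : interval R) (t : R) : t \in I ->
  exists T, [/\ T \in I, t <= T & \forall r \near t, r \in I -> r <= T].
Proof.
move=> tI; have [[T [TI tT]]|noT] := pselect (exists T, T \in I /\ t < T).
  exists T; split => //; first exact: ltW.
  by near=> r => _; apply: ltW; near: r; exact: lt_nbhsl.
exists t; split => //; near=> r => rI; rewrite leNgt; apply/negP => tr.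
by apply: noT; exists r.
Unshelve. all: by end_near. Qed.

Lemma subset_itv_interval {R : realType} (I : interval R) (s t : R) :
  s \in I -> t \in I -> `[s, t] `<=` [set` I].
Proof.
move=> sI tI r /=; rewrite in_itv/= => srt.
exact: (interval_is_interval sI tI).
Qed.

Section continuous_clip.
Context {R : realType} {m p : nat}.
Variables (t0 T : R) (F : R -> 'M[R]_(m, p)).
Hypotheses (t0T : t0 <= T) (cF : {within `[t0, T], continuous F}).

Let cFij i j : {within `[t0, T], continuous (fun s => F s i j)}.
Proof.
move=> s; apply: (@continuous_comp _ _ _ (F : subspace _ -> _) (fun M => M i j)).
  exact: cF.
exact: coord_continuous.
Qed.

Lemma measurable_clip i j : measurable_fun setT (fun s => clip t0 T F s i j).
Proof.
rewrite (_ : (fun _ => _) = (fun s => F s i j) \_ `[t0, T]).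
  apply/(measurable_restrictT _ _).1 => //.
  exact: (subspace_continuous_measurable_fun (measurable_itv _) (@cFij i j)).
apply/funext => s; rewrite patchE mem_setE in_itv/= /clip.
by case: ifP => // _; rewrite mxE.
Qed.

Lemma bounded_clip : exists M, forall s i j, `|clip t0 T F s i j| <= M.
Proof.
have h i j : exists M, forall s, `|clip t0 T F s i j| <= M.
  have cn : {within `[t0, T], continuous (fun s => `|F s i j|)}.
    move=> s; apply: (@continuous_comp _ _ _ ((fun s => F s i j) : subspace _ -> _) Num.norm).
      exact: cFij.
    exact: norm_continuous.
  have [c _ hc] := EVT_max t0T cn.
  exists `|F c i j| => s; rewrite /clip; case: ifPn => st; first exact: hc.
  by rewrite mxE normr0.
have /choice[M1 hM1] : forall ij, exists M, forall s, `|clip t0 T F s ij.1 ij.2| <= M.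
  by move=> ij; exact: h.
exists (\sum_ij M1 ij) => s i j.
rewrite (bigD1 (i, j))//= -[leLHS]addr0 lerD//; first exact: (hM1 (i, j)).
by apply: sumr_ge0 => ij _; exact: le_trans (hM1 ij s).
Qed.
End continuous_clip.

Section compact_interval.
Context {R : realType} {n : nat}.
Notation mu := (@lebesgue_measure R).
Variables (a t0 T : R) (A : R -> 'M[R]_n) (u : R -> 'cV[R]_n) (x0 : 'cV[R]_n).
Hypotheses (a_gt0 : 0 < a) (a_lt1 : a < 1) (t0T : t0 <= T).
Hypotheses (cA : {within `[t0, T], continuous A})
  (cu : {within `[t0, T], continuous u}).

Let x := PB_sol a t0 A u x0.

(** On a compact interval the formula satisfies the Volterra equation; phi is
    A x + u, cut off outside [t0, T]. *)
Lemma PB_sol_rlint : exists (phi : 'I_n -> R -> R) (F : R),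
  [/\ forall i, measurable_fun setT (phi i),
      forall i s, `|phi i s| <= F,
      forall i s, ~~ (t0 <= s <= T) -> phi i s = 0,
      forall i s, t0 <= s <= T -> phi i s = (A s *m x s + u s) i 0 &
      forall i t, t0 <= t <= T -> x t i 0 = x0 i 0 + rlint a (phi i) t].
Proof.
have a1 := ltW a_lt1.
have [M AM] := bounded_clip t0T cA.
have [Ub uU] := bounded_clip t0T cu.
have [] := @neumann_solP R n a t0 T M Ub (clip t0 T A) (fun l s => clip t0 T u s l 0)
  (fun l => x0 l 0) a_gt0 a1 (measurable_clip cA) AM.
- by move=> s i j sN; rewrite /clip (negbTE sN) mxE.
- by move=> i; exact: measurable_clip.
- by move=> i s.
- by move=> i s sN; rewrite /clip (negbTE sN) mxE.
set phi := neumann_rhs _ _ _ _ _ => mphi [F phiF] yE c1 c2.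
have xE i t : t0 <= t <= T -> x t i 0 = neumann_sol a t0 (clip t0 T A)
    (fun l s => clip t0 T u s l 0) (fun l => x0 l 0) i t.
  by move=> /andP[t0t tT]; apply: PB_sol_neumann.
exists phi, F; split => //.
- move=> i s sN; rewrite /phi /neumann_rhs /clip (negbTE sN) mxE addr0.
  by rewrite big1// => l _; rewrite mxE mul0r.
- move=> i s st; rewrite /phi /neumann_rhs !mxE; congr (_ + _).
    by apply: eq_bigr => l _; rewrite xE// /clip st.
  by rewrite /clip st.
- move=> i t tt; rewrite xE// yE; congr (_ + _).
  by rewrite indicE mem_setE in_itv/= andbT; case/andP: tt => -> _; rewrite mul1r.
Qed.
End compact_interval.

(** * The two Caputo derivatives *)

Lemma derive_quotient {R : realType} (F : R -> R) (t v : R) :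
  derivable F t 1 -> derive1 F t = v ->
  (F r - F t) / (r - t) @[r --> t^'] --> v.
Proof.
move=> dF Fv; apply/cvgr_dnbhsP => w [wt wcv].
have /cvgr_dnbhsP/(_ (fun m => w m - t)) : h^-1 *: (F (h + t) - F t) @[h --> 0^'] --> v.
  rewrite -Fv derive1E; move: dF; rewrite /derivable /derive.
  under eq_fun do rewrite [_ *: 1]mulr1.
  exact.
move=> /(_ _).
have h1 : (forall m, w m - t != 0) /\ w m - t @[m --> \oo] --> 0.
  split; first by move=> m; rewrite subr_eq0.
  by rewrite -(subrr t); apply: cvgB => //; exact: cvg_cst.
move=> /(_ h1); apply: cvg_trans; apply: near_eq_cvg; apply: nearW => m /=.
by rewrite subrK /GRing.scale/= mulrC.
Qed.

Section caputo_rlint.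
Context {R : realType}.
Notation mu := (@lebesgue_measure R).
Implicit Types (f g : R -> R) (r s t : R).

Lemma Rintegral_tpow1 g (c r : R) : measurable_fun setT g ->
  (forall s, s < c -> g s = 0) -> mu.-integrable `[c, r[ (EFin \o g) ->
  \int[mu]_s (tpow 1 (r - s) * g s) = \int[mu]_(s in `[c, r]) g s.
Proof.
move=> mg gc ig; rewrite -Rintegral_itv_bndo_bndc// [RHS]Rintegral_mkcond.
apply: eq_Rintegral => s _; rewrite patchE mem_setE in_itv/= tpow1 subr_gt0.
have [sr|_] := ltP s r; last by rewrite andbF mul0r.
by rewrite andbT mul1r; case: leP => // /gc.
Qed.

(** As t may be equal to T, the function g need not be continuous at t on both
    sides.  Freezing it at its value g T beyond T makes it so, and does not change
    the integrals up to r <= T. *)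
Lemma derivable_Rintegral_tpow1 g (t0 T t F : R) : measurable_fun setT g ->
  (forall s, `|g s| <= F) -> (forall s, ~~ (t0 <= s <= T) -> g s = 0) ->
  t0 < t -> t <= T ->
  g s @[s --> within `[t0, T] (nbhs t)] --> g t ->
  exists G : R -> R, [/\ derivable G t 1, derive1 G t = g t &
    forall r, t0 <= r <= T -> G r = \int[mu]_s (tpow 1 (r - s) * g s)].
Proof.
move=> mg gF g0 t0t tT gt.
pose f s := g (Num.min s T).
have mf : measurable_fun setT f.
  by apply: measurableT_comp => //; exact: measurable_minr.
have ibnd (h : R -> R) (D : set R) : measurable D -> (mu D < +oo)%E ->
    measurable_fun setT h -> (forall s, `|h s| <= F) ->
    mu.-integrable D (EFin \o h).
  move=> mD muD mh hF; apply: measurable_bounded_integrable => //.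
    exact: measurable_funTS.
  exists F; split; first exact: num_real.
  by move=> y Fy s _; exact: le_trans (hF s) (ltW Fy).
have muitv (b1 b2 : bool) (p q : R) :
    (mu [set` Interval (BSide b1 p) (BSide b2 q)] < +oo)%E.
  by rewrite lebesgue_measure_itv/=; case: ifP => _; rewrite ?ltry// -EFinB ltry.
have cf : {for t, continuous f}.
  apply/cvgrPdist_le => /= e e0.
  have /cvgrPdist_le/(_ e e0)[d /= d0 hd] := gt.
  near=> s; rewrite {1}/f min_l//; apply: (hd (Num.min s T)).
    rewrite /ball_/=; have sd : `|t - s| < d by near: s; exists d.
    rewrite /Num.min; case: ifPn => //; rewrite -leNgt => Ts.
    apply: le_lt_trans sd; rewrite !ler0_norm ?subr_le0 ?(le_trans tT)//.
    by rewrite lerN2 lerD2l lerN2.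
  rewrite /= in_itv/= ge_min lexx orbT andbT le_min (le_trans (ltW t0t) tT) andbT.
  by apply: ltW; near: s; exact: lt_nbhsr.
have [dG G't] := @continuous_FTC1_closed R f t0 t (t + 1) (ltr_pwDr ltr01 (lexx t))
  (ibnd _ _ (measurable_itv _) (muitv _ _ _ _) mf (fun s => gF _)) t0t cf.
exists (fun r => \int[mu]_(s in `[t0, r]) f s); split => //.
  by rewrite G't /f min_l.
move=> r /andP[t0r rT]; rewrite (@Rintegral_tpow1 _ t0)//.
- apply: eq_Rintegral => s; rewrite inE/= in_itv/= => /andP[_ sr].
  by rewrite /f min_l// (le_trans sr rT).
- by move=> s st0; rewrite g0// negb_and -ltNge st0.
- exact: ibnd.
Unshelve. all: by end_near. Qed.

Lemma rlint_causal (b c : R) g t : (forall s, s < c -> g s = 0) -> t <= c ->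
  rlint b g t = 0.
Proof.
by move=> g0 tc; rewrite /rlint (Rintegral_tpow_causal _ g0 tc) mulr0.
Qed.

(** This is the law J^(1-a) J^a = J^1, and comes from the Beta integral. *)
Lemma rlint_beta (a c F : R) g t : 0 < a -> a < 1 -> measurable_fun setT g ->
  (forall s, `|g s| <= F) -> (forall s, s <= c -> g s = 0) ->
  rlint (1 - a) (rlint a g) t = \int[mu]_s (tpow 1 (t - s) * g s).
Proof.
move=> a0 a1 mg gF gc.
have b0 : 0 < 1 - a by rewrite subr_gt0.
have b1 : 1 - a <= 1 by rewrite gerBl ltW.
have Ga : 0 < Gamma a by rewrite Gamma_gt0// ltW.
have Gb : 0 < Gamma (1 - a) by rewrite Gamma_gt0.
have ia (p s : R) : 0 < p -> mu.-integrable setT (fun q => (tpow p (s - q) * g q)%:E).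
  by move=> p0; exact: (rlint_integrable s p0 mg gF gc).
rewrite /rlint.
transitivity ((Gamma (1 - a))^-1 * \int[mu]_s (tpow (1 - a) (t - s) *
    \int[mu]_q (tpow a (s - q) * ((Gamma a)^-1 * g q)))).
  congr (_ * _); apply: eq_Rintegral => s _; congr (_ * _).
  rewrite -RintegralZl//; last exact: ia.
  by apply: eq_Rintegral => q _; rewrite mulrCA.
have iG (p s : R) : 0 < p ->
    mu.-integrable setT (fun q => (tpow p (s - q) * ((Gamma a)^-1 * g q))%:E).
  move=> p0; under eq_fun do rewrite mulrCA; apply: integrableM_EFin; exact: ia.
rewrite (@rlint_rlint _ (1 - a) a 1 (Gamma (1 - a) * Gamma a) t); last 5 first.
- exact: ltW (mulr_gt0 Gb Ga).
- by move=> r; rewrite integral_tpow_conv_shift beta_tpow// subrK.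
- by meas.
- by move=> s; exact: iG.
- exact: iG.
rewrite !mulrA (mulVf (lt0r_neq0 Gb)) mul1r -RintegralZl; last 2 first.
- exact: measurableT.
- exact: iG.
by apply: eq_Rintegral => s _; rewrite mulrCA mulVKf// gt_eqF.
Qed.

(** By [rlint_beta], J^(1-a) (f - f t0) is the ordinary integral of g, so the
    regularized derivative of f is g, at each point t where g is continuous. *)
Lemma is_caputo_rlint (I : interval R) (a t0 T t F : R) f g :
  0 < a -> a < 1 -> t0 < t -> t <= T -> (\forall r \near t, r \in I -> r <= T) ->
  measurable_fun setT g -> (forall s, `|g s| <= F) ->
  (forall s, ~~ (t0 <= s <= T) -> g s = 0) ->
  g s @[s --> within `[t0, T] (nbhs t)] --> g t ->
  (forall r, t0 <= r <= T -> f r = f t0 + rlint a g r) ->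
  is_caputo I a t0 f t (g t).
Proof.
move=> a0 a1 t0t tT nearT mg gF g0 gt fE.
have [G [dG G't GE]] := derivable_Rintegral_tpow1 mg gF g0 t0t tT gt.
have b0 : 0 < 1 - a by rewrite subr_gt0.
have b1 : 1 - a <= 1 by rewrite gerBl ltW.
have gc s : s <= t0 - 1 -> g s = 0.
  move=> st0; rewrite g0//; apply/negP => /andP[t0s _].
  by have := le_trans t0s st0; rewrite lerBrDr gerDl ler10.
have FG r : t0 <= r <= T -> RL_int (1 - a) t0 (fun s => f s - f t0) r = G r.
  move=> /andP[t0r rT]; rewrite GE ?t0r//.
  rewrite (@RL_int_rlint _ _ _ _ _ (rlint a g)); last 3 first.
  - by rewrite lt_eqF// gtrBl.
  - move=> s t0s sr; rewrite fE ?t0s ?(le_trans (ltW sr))//.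
    by rewrite addrC addKr.
  - move=> s st0; apply: (@rlint_causal a t0); last exact: ltW.
    by move=> q qt0; rewrite g0// negb_and -ltNge qt0.
  exact: (rlint_beta r a0 a1 mg gF gc).
have : (G r - G t) / (r - t) @[r --> within [set` I] t^'] --> g t.
  by apply: cvg_within_filter; apply: derive_quotient.
apply: cvg_trans; apply: near_eq_cvg.
have tt : t0 <= t <= T by rewrite (ltW t0t).
have h : \forall r \near within [set` I] t^', t0 <= r <= T.
  rewrite !near_withinE; near=> r => _ rI; apply/andP; split.
    by apply: ltW; near: r; exact: lt_nbhsr.
  by move: rI; near: r.
by apply: filterS h => r rT; rewrite !FG.
Unshelve. all: by end_near. Qed.

(** For w > h this is the concavity of v^b, in the form
    (1 - h / w)^b >= 1 - h / w. *)
Lemma tpow_quotient_le (b h w : R) : 0 < b -> b <= 1 -> 0 < h ->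
  0 <= (tpow (b + 1) w - tpow (b + 1) (w - h)) / (b * h) <= tpow b w / b.
Proof.
move=> b0 b1 h0; have b'1 : 1 <= b + 1 by rewrite lerDr ltW.
apply/andP; split.
  by rewrite divr_ge0 ?mulr_ge0 ?(ltW b0) ?(ltW h0)// subr_ge0 le_tpow// gerBl ltW.
rewrite invfM mulrA mulrAC ler_pM2r ?invr_gt0// ler_pdivrMr//.
have [w0|w0] := leP w 0.
  rewrite !tpow_nonpos ?mul0r ?subrr//.
  by rewrite (le_trans _ w0)// gerBl ltW.
have wE : tpow (b + 1) w = w * tpow b w.
  by rewrite !tpow_pos// addrK mulr_powRB1// ltW.
have [wh|hw] := leP w h.
  rewrite (@tpow_nonpos _ _ (w - h)) ?subr_le0// subr0 wE mulrC.
  by rewrite ler_wpM2l ?tpow_ge0.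
have wh0 : 0 < w - h by rewrite subr_gt0.
suff : w `^ b * ((w - h) / w) <= tpow (b + 1) (w - h).
  rewrite wE (tpow_pos _ w0) => k; rewrite lerBlDr.
  apply: le_trans (lerD (lexx (w `^ (b - 1) * h)) k).
  rewrite -(@mulr_powRB1 _ w b (ltW w0) b0) le_eqVlt; apply/orP; left; apply/eqP.
  by field; exact: lt0r_neq0.
rewrite tpow_pos// addrK.
have -> : (w - h) `^ b = w `^ b * ((w - h) / w) `^ b.
  rewrite -powRM ?(ltW w0) ?divr_ge0 ?(ltW wh0) ?(ltW w0)//.
  by congr (_ `^ _); field; exact: lt0r_neq0.
rewrite ler_wpM2l ?powR_ge0//; apply: ger1_powR => //.
by rewrite divr_gt0//= ler_pdivrMr// mul1r gerBl ltW.
Qed.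

Lemma tpow_quotient_cvg (b : R) w (h : nat -> R) : 0 < b ->
  (forall m, 0 < h m) -> h m @[m --> \oo] --> 0 ->
  (tpow (b + 1) w - tpow (b + 1) (w - h m)) / (b * h m) @[m --> \oo] --> tpow b w.
Proof.
move=> b0 h0 hcv; have [w0|w0] := leP w 0.
  rewrite (tpow_nonpos _ w0); apply: cvg_near_cst; apply: nearW => m.
  rewrite !tpow_nonpos ?subrr ?mul0r//.
  by rewrite (le_trans _ w0)// gerBl ltW.
have [dF F'E] := is_derive_powR_div (lt0r_neq0 b0) w0.
have := derive_quotient dF _; rewrite derive1E F'E => /(_ _ erefl)/cvgr_dnbhsP.
have hw0 : (forall m, w - h m != w) /\ w - h m @[m --> \oo] --> w.
  split; first by move=> m; rewrite lt_eqF// gtrBl.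
  by rewrite -[X in _ --> X]subr0; apply: cvgB => //; exact: cvg_cst.
move=> /(_ _ hw0); rewrite [X in _ -> _ --> X]tpow_pos//.
apply: cvg_trans; apply: near_eq_cvg; near=> m => /=.
have hw : 0 < w - h m by rewrite subr_gt0; near: m; exact: (cvgr_lt 0 hcv).
rewrite !tpow_pos// !addrK (_ : w - h m - w = - h m); last by ring.
by field; rewrite !lt0r_neq0.
Unshelve. all: by end_near. Qed.

Lemma integrable_patch (D : set R) g : measurable D ->
  mu.-integrable D (EFin \o g) -> mu.-integrable setT (fun s => ((g \_ D) s)%:E).
Proof.
move=> mD ig; rewrite -[X in _.-integrable _ X]/(EFin \o (g \_ D)) -restrict_EFin.
by apply/integrable_restrict => //=; rewrite setTI.
Qed.

(** Put b = 1 - a.  As f is the integral of f', Fubini gives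
    J^b (f - f t0) = J^(b+1) f'.  A difference quotient of the right-hand side
    at t has as kernel a difference quotient of [tpow (b + 1)], which tends to
    [tpow b] up to a constant and is dominated by it ([tpow_quotient_le]); so
    the difference quotients tend to J^b f' at t.  They are taken on the left of
    t, because f' is only controlled on [t0, t]. *)
Lemma caputo_of_is_caputo (I : interval R) (a t0 t v : R) f : 0 < a -> a < 1 ->
  t0 \in I -> t \in I -> t0 < t -> caputo_defined a t0 f t ->
  is_caputo I a t0 f t v -> caputo a t0 f t = v.
Proof.
move=> a0 a1 t0I tI t0t [id fE ik] fv.
have quotientE (g p q y z : R) : g != 0 -> p != 0 -> q != 0 ->
    (g^-1 * (p^-1 * z) - g^-1 * (p^-1 * y)) / - q = g^-1 * ((p * q)^-1 * (y - z)).
  by move=> g0 p0 q0; field; rewrite g0 p0 q0.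
pose b := 1 - a; have b0 : 0 < b by rewrite subr_gt0.
have b1 : b <= 1 by rewrite gerBl ltW.
have bN1 : b != 1 by rewrite lt_eqF// gtrBl.
pose d : R -> R := derive1 f \_ `[t0, t].
have dE s : d s = if t0 <= s <= t then derive1 f s else 0.
  by rewrite /d patchE mem_setE in_itv.
have d0 s : s < t0 -> d s = 0 by move=> st0; rewrite dE leNgt st0.
have di : mu.-integrable setT (fun s => (d s)%:E).
  exact: (integrable_patch (measurable_itv `[t0, t]) id).
have md : measurable_fun setT d by apply/measurable_EFinP; exact: (measurable_int _ di).
have ki : mu.-integrable setT (fun s => (tpow b (t - s) * d s)%:E).
  have := integrable_patch (measurable_itv `[t0, t]) ik.
  apply: eq_integrable => // s _ /=; congr EFin.
  rewrite patchE mem_setE in_itv/= dE; case: ifPn => [/andP[_ st]|_]; last first.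
    by rewrite mulr0.
  rewrite /RL_integrand -/b; move: st; rewrite le_eqVlt => /predU1P[->|st].
    by rewrite subrr tpow_nonpos// powR0 ?mul0r// subr_eq0.
  by rewrite tpow_pos ?subr_gt0.
have i1 r : mu.-integrable setT (fun s => (tpow 1 (r - s) * d s)%:E).
  apply: le_integrable di => //; first by meas.
  move=> s _ /=; rewrite lee_fin normrM tpow1 normr_nat ler_piMl//.
  by case: (_ < _).
have i2 r : mu.-integrable setT (fun s => (tpow (b + 1) (r - s) * d s)%:E).
  apply: le_integrable (integrableM_EFin (tpow (b + 1) (r - t0)) di) => //; first by meas.
  move=> s _ /=; rewrite lee_fin !normrM.
  have [st0|t0s] := ltP s t0; first by rewrite d0// normr0 !mulr0.
  rewrite ler_wpM2r// !ger0_norm ?tpow_ge0// le_tpow ?lerDr ?(ltW b0)//.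
  by rewrite lerD2l lerN2.
pose F := RL_int b t0 (fun s => f s - f t0).
have FE r : t0 <= r <= t -> F r =
    (Gamma b)^-1 * (b^-1 * \int[mu]_s (tpow (b + 1) (r - s) * d s)).
  move=> /andP[t0r rt]; rewrite /F.
  rewrite (@RL_int_rlint _ _ _ _ _ (fun q => \int[mu]_s (tpow 1 (q - s) * d s)))//.
  - congr (_ * _); apply: rlint_rlint => //; first by rewrite invr_ge0 ltW.
    by move=> q; rewrite integral_tpow_conv_tpow1// mulrC.
  - move=> q t0q qr; have qt : q <= t by rewrite (le_trans (ltW qr)).
    rewrite fE ?in_itv/= ?t0q// addrC addKr (@Rintegral_tpow1 _ t0)//.
      apply: eq_Rintegral => s; rewrite inE/= in_itv/= => /andP[t0s sq].
      by rewrite dE t0s (le_trans sq).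
    by apply: integrableS di => //; exact: measurable_itv.
  - by move=> q qt0; rewrite (Rintegral_tpow_causal _ d0)// ltW.
have -> : caputo a t0 f t = (Gamma b)^-1 * \int[mu]_s (tpow b (t - s) * d s).
  rewrite /caputo (@RL_int_rlint _ _ _ _ _ d)// => s t0s st.
  by rewrite dE t0s (ltW st).
pose h (m : nat) : R := (t - t0) / m.+1%:R.
have h0 m : 0 < h m by rewrite divr_gt0 ?subr_gt0.
have hcv : h m @[m --> \oo] --> 0.
  by rewrite -[X in _ --> X](mulr0 (t - t0)); apply: cvgMl_tmp; exact: cvg_harmonic.
have hle m : h m <= t - t0.
  by rewrite ler_pdivrMr// ler_peMr ?ler1n// subr_ge0 ltW.
have thcv : t - h m @[m --> \oo] --> t.
  by rewrite -[X in _ --> X]subr0; apply: cvgB => //; exact: cvg_cst.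
have ht m : t0 <= t - h m <= t.
  by apply/andP; split; [rewrite lerBrDr addrC -lerBrDr|rewrite gerBl ltW].
have thI : t - h m @[m --> \oo] --> within [set` I] t^'.
  move=> P hP.
  have H : \forall m \near \oo, t - h m != t -> t - h m \in I -> P (t - h m).
    exact: (thcv _ hP).
  apply: (filterS _ H) => m; apply.
    by rewrite lt_eqF// gtrBl.
  by apply: (interval_is_interval t0I tI); exact: ht.
have lim1 : (F (t - h m) - F t) / (t - h m - t) @[m --> \oo] --> v.
  exact: (cvg_comp _ _ thI fv).
pose Q m s := (tpow (b + 1) (t - s) - tpow (b + 1) (t - s - h m)) / (b * h m).
have lim2 : (Gamma b)^-1 * \int[mu]_s (Q m s * d s) @[m --> \oo] -->
    (Gamma b)^-1 * \int[mu]_s (tpow b (t - s) * d s).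
  apply: cvgMl_tmp.
  apply: (Rintegral_dominated_cvg (G := fun s => b^-1 * `|tpow b (t - s) * d s|)).
  - by move=> m; rewrite /Q; meas.
  - apply: integrableM_EFin; exact: (integrable_norm ki).
  - move=> m s; have /andP[q0 q1] := tpow_quotient_le (t - s) b0 b1 (h0 m).
    rewrite (normrM (Q m s)) (normrM (tpow _ _)) mulrA ler_wpM2r//.
    by rewrite (ger0_norm q0) (ger0_norm (tpow_ge0 _ _)) [leRHS]mulrC.
  - by move=> s; apply: cvgMr_tmp; exact: tpow_quotient_cvg.
apply: (cvg_unique (@Rhausdorff R) lim2).
apply: cvg_trans lim1; apply: near_eq_cvg; apply: nearW => m.
rewrite !FE ?lexx ?andbT ?(ltW t0t)//.
have -> : \int[mu]_s (Q m s * d s) = (b * h m)^-1 *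
    (\int[mu]_s (tpow (b + 1) (t - s) * d s) -
     \int[mu]_s (tpow (b + 1) (t - h m - s) * d s)).
  rewrite -RintegralB//; [|exact: i2|exact: i2].
  rewrite -RintegralZl//; last exact: integrableB_EFin.
  apply: eq_Rintegral => s _; rewrite /Q (_ : t - h m - s = t - s - h m).
    by rewrite -mulrBl [RHS]mulrCA -mulrA.
  by ring.
rewrite (_ : t - h m - t = - h m); last by ring.
by apply: quotientE; rewrite gt_eqF// Gamma_gt0.
Qed.
End caputo_rlint.

(** * The initial value problem *)

Theorem theorem5 (R : realType) (n : nat) (a : R) (I : interval R) (t0 : R)
    (A : R -> 'M[R]_n) (u : R -> 'cV[R]_n) (x0 : 'cV[R]_n)
    (a_gt0 : 0 < a) (a_lt1 : a < 1) (t0I : t0 \in I)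
    (A_cont : {within [set` I], continuous A})
    (u_cont : {within [set` I], continuous u})
    (Phi_unif : {uniform [set t | t \in I /\ t0 <= t],
       (fun N t => series (fun k => caputo_term a t0 A k t) N) @ \oo
         --> (fun t => caputo_Phi a A t t0)}) :
  caputo_solution I a t0 A u x0
    (fun t => caputo_Phi a A t t0 *m x0 +
       \col_i \int[lebesgue_measure]_(tau in `[t0, t])
                (RL_Phi a A t tau *m u tau) i 0).
Proof.
rewrite -/(PB_sol a t0 A u x0); set x := PB_sol a t0 A u x0.
have cW m (B : R -> 'M[R]_(n, m)) T : {within [set` I], continuous B} -> T \in I ->
    {within `[t0, T], continuous B}.
  by move=> cB TI; apply: continuous_subspaceW cB; exact: subset_itv_interval.
have sol T : T \in I -> t0 <= T ->
  exists (phi : 'I_n -> R -> R) (F : R),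
  [/\ forall i, measurable_fun setT (phi i),
      forall i s, `|phi i s| <= F,
      forall i s, ~~ (t0 <= s <= T) -> phi i s = 0,
      forall i s, t0 <= s <= T -> phi i s = (A s *m x s + u s) i 0 &
      forall i t, t0 <= t <= T -> x t i 0 = x0 i 0 + rlint a (phi i) t].
  by move=> TI t0T; apply: PB_sol_rlint => //; exact: cW.
have rl0 (phi : 'I_n -> R -> R) T i :
    (forall i s, ~~ (t0 <= s <= T) -> phi i s = 0) -> rlint a (phi i) t0 = 0.
  move=> phi0; apply: (@rlint_causal _ a t0) => // s st0.
  by rewrite phi0// negb_and -ltNge st0.
have supp0 (phi : 'I_n -> R -> R) T i :
    (forall i s, ~~ (t0 <= s <= T) -> phi i s = 0) ->
    forall s, s <= t0 - 1 -> phi i s = 0.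
  move=> phi0 s st0; rewrite phi0//; apply/negP => /andP[t0s _].
  by have := le_trans t0s st0; rewrite lerBrDr gerDl ler10.
have x_t0 : x t0 = x0.
  have [phi [F [_ _ phi0 _ xE]]] := sol t0 t0I (lexx t0).
  apply/matrixP => i j; rewrite ord1 xE ?lexx//.
  by rewrite (rl0 phi t0 i phi0) addr0.
(* Continuity at t only involves points of I near t, and these lie in a compact
   interval [t0, T]. *)
have xcvg t T : T \in I -> t0 <= t -> t <= T ->
    x s @[s --> within `[t0, T] (nbhs t)] --> x t.
  move=> TI t0t tT.
  have [phi [F [mphi phiF phi0 _ xE]]] := sol T TI (le_trans t0t tT).
  apply: cvg_mx_entries => i j; rewrite (ord1 j).
  have c : x0 i 0 + rlint a (phi i) s @[s --> t] --> x t i 0.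
    rewrite xE ?t0t//; apply: cvgD; first exact: cvg_cst.
    exact: (continuous_rlint a_gt0 (ltW a_lt1) (mphi i) (phiF i) (supp0 phi T i phi0)).
  have : x0 i 0 + rlint a (phi i) s @[s --> within `[t0, T] (nbhs t)] --> x t i 0.
    exact: cvg_within_filter.
  apply: cvg_trans; apply: near_eq_cvg; rewrite near_withinE; apply: nearW => s /=.
  by rewrite in_itv/= => sT; rewrite xE.
split => //.
- apply/subspace_continuousP => t [tI t0t].
  have [T [TI tT nearT]] := interval_local_top tI.
  apply: cvg_trans (xcvg t T TI t0t tT); apply: cvg_app.
  move=> P hP; have hP' : \forall r \near t, `[t0, T]%classic r -> P r by exact: hP.
  suff : \forall r \near t, r \in I /\ t0 <= r -> P r by [].
  apply: filterS2 hP' nearT => r Pr rT [rI t0r].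
  by apply: Pr; rewrite /= in_itv/= t0r rT.
- move=> t tI t0t i xi v.
  have [T [TI tT nearT]] := interval_local_top tI.
  have [phi [F [mphi phiF phi0 phiE xE]]] := sol T TI (le_trans (ltW t0t) tT).
  have tt : t0 <= t <= T by rewrite (ltW t0t).
  have vE : v = phi i t by rewrite phiE.
  have ecvg m (B : R -> 'M[R]_(n, m)) k : {within [set` I], continuous B} ->
      B s i k @[s --> within `[t0, T] (nbhs t)] --> B t i k.
    move=> /cW/(_ TI)/subspace_continuousP/(_ t) h.
    by apply: cvg_mx_entry; apply: h; rewrite /= in_itv.
  have cap : is_caputo I a t0 xi t v.
    rewrite vE; apply: (is_caputo_rlint a_gt0 a_lt1 t0t tT nearT (mphi i) (phiF i)
      (phi0 i)).
      have : (A s *m x s + u s) i 0 @[s --> within `[t0, T] (nbhs t)] --> phi i t.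
        rewrite -vE /v.
        have rowE s : (A s *m x s + u s) i 0 = \sum_k A s i k * x s k 0 + u s i 0.
          by rewrite !mxE.
        rewrite rowE (funext rowE).
        apply: cvgD; last exact: (ecvg _ _ _ u_cont).
        apply: cvg_big => [|k _]; first exact: add_continuous.
        apply: cvgM; first exact: (ecvg _ _ _ A_cont).
        by apply: cvg_mx_entry; exact: (xcvg _ _ TI (ltW t0t) tT).
      apply: cvg_trans; apply: near_eq_cvg; rewrite near_withinE; apply: nearW => s /=.
      by rewrite in_itv/= => sT; rewrite phiE.
    by move=> r rT; rewrite /xi xE// x_t0.
  by split => // def; exact: (caputo_of_is_caputo a_gt0 a_lt1 t0I tI t0t def cap).
Unshelve. all: by end_near. Qed.
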